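(* Let $k\geq 3$ be an odd integer, let $G$ be a connected graph of order $n\geq 3$, and let $d$ be an integer with $1\le d<k$ and $n\equiv d\pmod 2$. (i) If $n$ is odd, or $n$ is even with $n\geq 10$, and $\lambda_1(D(G))\le \lambda_1(D(K_1\vee(K_{n-2}\cup K_1)))$, then $G$ is $k$-$d$-critical unless $G\cong K_1\vee(K_{n-2}\cup K_1)$. (ii) If $n$ is even with $4\le n\le 8$ and $\lambda_1(D(G))\le \lambda_1(D(S_{n,\frac{n}{2}}))$, then $G$ is $k$-$d$-critical unless $G\cong S_{n,\frac{n}{2}}$.
   Context: All graphs are finite, simple, undirected. For a connected graph $G$ with vertices $v_1,\dots,v_n$, the distance matrix $D(G)$ is the $n\times n$ matrix whose $(i,j)$-entry is the distance $d_G(v_i,v_j)$; $\lambda_1(D(G))$ denotes its largest eigenvalue. $G\cup H$ is the disjoint union, $G\vee H$ the join, $tK_1$ the edgeless graph on $t$ vertices, and $S_{n,k}=K_k\vee (n-k)K_1$. For a vertex $v$, $E_G(v)$ is the set of edges incident with $v$. A $k$-matching of $G$ is a function $h:E(G)\to\{0,1,\dots,k\}$ with $\sum_{e\in E_G(v)}h(e)\le k$ for every $v\in V(G)$. For odd $k\ge 3$, $1\le d\le k$ and $|V(G)|\equiv d\pmod 2$, $G$ is called $k$-$d$-critical if for every $v\in V(G)$ there is a $k$-matching $h$ with $\sum_{e\in E_G(v)}h(e)=k-d$ and $\sum_{e\in E_G(u)}h(e)=k$ for every $u\in V(G)\setminus\{v\}$. *)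

(* Defs.v *)
From HB Require Import structures.
From mathcomp Require Import all_boot all_order all_algebra.
From mathcomp Require Import boolp classical_sets reals.
Set Implicit Arguments. Unset Strict Implicit. Unset Printing Implicit Defensive.
Import Order.TTheory GRing.Theory Num.Theory.

Definition simple_graph (T : finType) (e : rel T) := symmetric e /\ irreflexive e.

Definition connected_graph (T : finType) (e : rel T) := forall x y : T, connect e x y.

Fixpoint reach (T : finType) (e : rel T) (m : nat) (x y : T) : bool :=
  match m with
  | 0 => x == y
  | m'.+1 => reach e m' x y || [exists z, reach e m' x z && e z y]
  end.

(* graph distance d_G(x,y): least m with y within m steps of x
   (for connected graphs this is < #|T|) *)
Definition dist (T : finType) (e : rel T) (x y : T) : nat :=
  find (fun m => reach e m x y) (iota 0 #|T|).

Definition distmx (R : realType) (n : nat) (e : rel 'I_n) : 'M[R]_n :=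
  \matrix_(i < n, j < n) ((dist e i j)%:R)%R.

Definition lambda1 (R : realType) (n : nat) (A : 'M[R]_n) : R :=
  sup [set a : R | eigenvalue A a].

Definition graph_iso (T : finType) (e1 e2 : rel T) :=
  exists f : T -> T, bijective f /\ forall x y, e1 x y = e2 (f x) (f y).

Definition edges (T : finType) (e : rel T) : {set {set T}} :=
  [set [set x; y] | x in T, y in T & e x y].

Definition hdeg (T : finType) (e : rel T) (h : {set T} -> nat) (v : T) : nat :=
  \sum_(f in edges e | v \in f) h f.

(* k-matching: h : E(G) -> {0,...,k} with sum at each vertex <= k
   (values of h outside E(G) are irrelevant) *)
Definition kmatching (T : finType) (e : rel T) (k : nat) (h : {set T} -> nat) :=
  (forall f, f \in edges e -> h f <= k) /\ (forall v, hdeg e h v <= k).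

Definition kd_critical (T : finType) (e : rel T) (k d : nat) :=
  forall v : T, exists h : {set T} -> nat,
    [/\ kmatching e k h, hdeg e h v = k - d &
        forall u, u != v -> hdeg e h u = k].

(* K_1 v (K_{n-2} u K_1) on 'I_n: vertex 0 universal, vertex n-1 pendant,
   vertices 1..n-2 form a clique *)
Definition kite_graph (n : nat) : rel 'I_n :=
  fun x y => (x != y) &&
    [|| val x == 0, val y == 0 | (val x != n.-1) && (val y != n.-1)].

(* S_{n,k} = K_k v (n-k)K_1 on 'I_n: vertices < k form the clique part *)
Definition S_graph (n k : nat) : rel 'I_n :=
  fun x y => (x != y) && ((val x < k) || (val y < k)).
Arguments kite_graph n : clear implicits.
Arguments S_graph n k : clear implicits.

(* Main.v *)
(* Blow every vertex x up into b x independent twins, with b = k - d at the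
   distinguished vertex and b = k elsewhere: a k-matching with the prescribed
   degrees is a perfect matching of the blow-up.  If there is none, Tutte's
   theorem gives a nonempty set S such that G - S has i isolated vertices and q
   components of order at least 3 with k i + q >= k |S| - d + 2.
   If i < |S|, then q >= 3 (|S| - i), so that G has more than 3n/2 non-edges and
   the all-ones vector gives lambda1 > n + 2, above the value of the kite.
   If i >= |S| = s, then G is a spanning subgraph of
   K_s v (K_{n-2s} u s K_1).  For s = 1 this is the kite, for 2s = n it is
   S_{n,n/2}, and removing edges strictly increases the form x D x^T at the
   positive Perron vector x; all other values of s are excluded by evaluating
   the form at a test vector constant on the three parts. *)
Require Import Defs.
From HB Require Import structures.
From mathcomp Require Import all_boot all_order all_algebra.
From mathcomp Require Import boolp reals perm.
From mathcomp Require complex spectral sesquilinear.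
From mathcomp Require Import ring lra zify.
Set Implicit Arguments. Unset Strict Implicit. Unset Printing Implicit Defensive.
Import Order.TTheory GRing.Theory Num.Theory.

(** * Tutte's theorem *)

Section Tutte.
Variable T : finType.
Implicit Types (e : rel T) (f g h : T -> T) (P A U : {set T}).

(** No distance of G is ever computed. D(G) dominates, entrywise, the matrix with 0 on the diagonal,
    1 at edges and 2 at non-edges, and equals it for the extremal graphs, which have diameter 2.
    Hence counting non-edges bounds lambda1(D(G)) from below through Rayleigh quotients, while
    positive test vectors bound the extremal values from above by Collatz-Wielandt. For large n
    crude vectors suffice; for small n the values to be separated can be within a hundredth of each
    other, which is why explicit decimals occur. *)

Definition perfect_matching e f := involutive f /\ forall x, e x (f x).

Definition pair_up f x y t := if t == x then y else if t == y then x else f t.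

Definition piecewise P f g t := if t \in P then f t else g t.

Lemma piecewise_involutive P f g :
  involutive f -> involutive g ->
  (forall t, t \in P -> f t \in P) -> (forall t, t \in P -> g t \in P) ->
  involutive (piecewise P f g).
Proof.
move=> fK gK fP gP t; rewrite /piecewise.
case: (boolP (t \in P)) => tP; first by rewrite fP.
case: ifP => [gtP|_]; last by [].
by move: (gP _ gtP); rewrite gK (negbTE tP).
Qed.

Lemma pair_up_perfect e h y z :
  symmetric e -> involutive h -> h y = y -> h z = z -> e y z ->
  (forall t, t != y -> t != z -> e t (h t)) ->
  perfect_matching e (pair_up h y z).
Proof.
move=> se hK hy hz eyz eh; split=> t; rewrite /pair_up.
  case: (eqVneq t y) => [->|ty].
    by case: (eqVneq z y) => [->//|_]; rewrite eqxx.
  case: (eqVneq t z) => [->|tz]; first by rewrite eqxx.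
  case: (eqVneq (h t) y) => [hty|_]; first by rewrite -(hK t) hty hy eqxx in ty.
  case: (eqVneq (h t) z) => [htz|_]; first by rewrite -(hK t) htz hz eqxx in tz.
  exact: hK.
case: (eqVneq t y) => [->//|ty].
case: (eqVneq t z) => [->|tz]; first by rewrite se.
exact: eh.
Qed.

Lemma pair_up_restrict e f x z :
  perfect_matching (fun a b => [|| e a b, (a == x) && (b == z) | (a == z) && (b == x)]) f ->
  f x = z ->
  [/\ involutive (fun t => if (t == x) || (t == z) then t else f t)
    & forall t, t != x -> t != z -> e t (f t)].
Proof.
move=> [fK fe] fx; have fz : f z = x by rewrite -fx fK.
split.
  move=> t; case: (eqVneq t x) => [->|tx] /=; first by rewrite eqxx.
  case: (eqVneq t z) => [->|tz] /=; first by rewrite eqxx orbT.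
  case: (eqVneq (f t) x) => [h|_]; first by rewrite -(fK t) h fx eqxx in tz.
  case: (eqVneq (f t) z) => [h|_]; first by rewrite -(fK t) h fz eqxx in tx.
  exact: fK.
move=> t tx tz; have := fe t; by rewrite (negbTE tx) (negbTE tz) orbF.
Qed.

(* The orbit of y under the two involutions is the alternating path issuing
   from its end y, so it has at most one other end. *)
Lemma alternating_path f g y : involutive f -> involutive g -> g y = y ->
  exists P, exists p,
  [/\ y \in P, (forall t, t \in P -> f t \in P), (forall t, t \in P -> g t \in P)
    & forall t, t \in P -> f t = t \/ g t = t -> t = y \/ t = p].
Proof.
move=> fK gK gy.
pose F j := if odd j then g else f.
pose fix a j := if j is j'.+1 then F j' (a j') else y.
have FK j : involutive (F j) by rewrite /F; case: ifP.
have aS j : a j.+1 = F j (a j) by [].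
(* The walk has not stalled before step j. A stall marks an end of the path: from there the walk
   only retraces itself. *)
pose Q j := forall i, i < j -> a i.+1 <> a i.
pose P := [set z | `[< exists2 j, z = a j & Q j >]].
have PP z : reflect (exists2 j, z = a j & Q j) (z \in P).
  by rewrite inE; apply: asboolP.
have next j : Q j -> F j (a j) \in P.
  move=> Qj; apply/PP; case: (eqVneq (a j.+1) (a j)) => [eqa|nea].
    by exists j.
  exists j.+1 => // i; rewrite ltnS leq_eqVlt => /orP[/eqP->|/Qj//].
  exact/eqP.
have prev j : Q j -> F j.+1 (a j) \in P.
  case: j => [|j] Qj; first by rewrite /F /= gy; apply/PP; exists 0.
  have -> : F j.+2 = F j by rewrite /F /= negbK.
  rewrite aS FK; apply/PP; exists j => // i ij; apply: Qj; exact: ltnW.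
have nxp (h : T -> T) j : h = f \/ h = g -> h = F j \/ h = F j.+1.
  by rewrite /F /=; case: (odd j) => /= -[]; auto.
have closed h : h = f \/ h = g -> forall t, t \in P -> h t \in P.
  move=> hfg t /PP[j -> Qj]; case: (nxp h j hfg) => ->; [exact: next|exact: prev].
have ends h : h = f \/ h = g -> forall t, t \in P -> h t = t -> t <> y ->
    exists j, [/\ t = a j, Q j & a j.+1 = a j].
  move=> hfg t /PP[j -> Qj] ht ty; exists j; split=> //.
  case: (nxp h j hfg) => eh; first by rewrite aS -eh.
  case: j Qj eh ht ty => [|j] Qj eh ht ty; first by case: ty.
  have ej : F j.+2 = F j by rewrite /F /= negbK.
  have := Qj j (ltnSn j); case.
  by rewrite -[RHS](FK j) -aS -ej -eh ht.
have uniq_end j1 j2 : Q j1 -> Q j2 -> a j1.+1 = a j1 -> a j2.+1 = a j2 -> j1 = j2.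
  move=> Q1 Q2 e1 e2; case: (ltngtP j1 j2) => // lt.
    by case: (Q2 _ lt).
  by case: (Q1 _ lt).
have yP : y \in P by apply/PP; exists 0.
have ends' t : t \in P -> f t = t \/ g t = t -> t <> y ->
    exists j, [/\ t = a j, Q j & a j.+1 = a j].
  by move=> tP [] ht; [apply: (ends f)|apply: (ends g)] => //; [left|right].
have [[p [pP pe py]]|nop] :=
    pselect (exists p, [/\ p \in P, f p = p \/ g p = p & p <> y]).
  exists P, p; split=> // [||t tP te]; [by apply: closed; left|by apply: closed; right|].
  have [->|/eqP ty] := eqVneq t y; first by left.
  right; have [i [-> Qi ei]] := ends' t tP te ty.
  have [j [-> Qj ej]] := ends' p pP pe py.
  by rewrite (uniq_end i j).
exists P, y; split=> // [||t tP te]; [by apply: closed; left|by apply: closed; right|].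
left; apply/eqP/negPn/negP => /eqP ty; apply: nop; by exists t.
Qed.

Lemma involution_even A h : involutive h -> (forall t, t \in A -> h t \in A) ->
  (forall t, t \in A -> h t != t) -> ~~ odd #|A|.
Proof.
move=> hK; have [m] := ubnP #|A|; elim: m A => // m IH A lAm hA hn.
have [->|[x xA]] := set_0Vmem A; first by rewrite cards0.
have hxA : h x \in A :\ x by rewrite !inE hn // hA.
have hB t : (t \in A :\ x :\ h x) = [&& t != h x, t != x & t \in A].
  by rewrite !inE.
rewrite (cardsD1 x) xA (cardsD1 (h x)) hxA /= negbK.
apply: IH.
- by move: lAm; rewrite (cardsD1 x A) xA (cardsD1 (h x) (A :\ x)) hxA; lia.
- move=> t; rewrite !hB => /and3P[t1 t2 t3]; rewrite hA // andbT.
  rewrite (inj_eq (inv_inj hK)) t2 /=.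
  by apply: contra t1 => /eqP <-; rewrite hK.
- by move=> t; rewrite hB => /and3P[_ _]; exact: hn.
Qed.

(* The exchange step in Lovasz's proof of Tutte's theorem: two perfect matchings,
   of e + xz and of e + yw, are spliced along an alternating path starting at y. *)
Lemma matching_exchange e x y z w f g :
  symmetric e -> irreflexive e -> x != y -> y != z -> x != z -> y != w -> w != x -> w != z ->
  e x y -> e y z ->
  perfect_matching (fun a b => [|| e a b, (a == x) && (b == z) | (a == z) && (b == x)]) f ->
  perfect_matching (fun a b => [|| e a b, (a == y) && (b == w) | (a == w) && (b == y)]) g ->
  exists h, perfect_matching e h.
Proof.
move=> se ie xy yz xz yw wx wz exy eyz pf pg.
have trivial_case (a b : T) (h : T -> T) :
    perfect_matching (fun s t => [|| e s t, (s == a) && (t == b) | (s == b) && (t == a)]) h ->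
    h a <> b -> perfect_matching e h.
  move=> [hK he] hab; split=> // t; have := he t; case/or3P => //.
    by case/andP => /eqP-> /eqP.
  by case/andP => /eqP-> /eqP hb; case: hab; rewrite -hb hK.
have [fx|/eqP fx] := eqVneq (f x) z; last by exists f; apply: trivial_case pf fx.
have [gy|/eqP gy] := eqVneq (g y) w; last by exists g; apply: trivial_case pg gy.
have [fK fe] := pair_up_restrict pf fx.
have [gK ge] := pair_up_restrict pg gy.
set f' := fun t => _ in fK; set g' := fun t => _ in gK.
have f'x : f' x = x by rewrite /f' eqxx.
have f'z : f' z = z by rewrite /f' eqxx orbT.
have g'y : g' y = y by rewrite /g' eqxx.
have g'w : g' w = w by rewrite /g' eqxx orbT.
have f'e t : t != x -> t != z -> e t (f' t).
  by move=> tx tz; rewrite /f' (negbTE tx) (negbTE tz); exact: fe.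
have g'e t : t != y -> t != w -> e t (g' t).
  by move=> ty tw; rewrite /g' (negbTE ty) (negbTE tw); exact: ge.
have [P [p [yP Pf Pg Pe]]] := alternating_path fK gK g'y.
have endp t : t \in P -> t != y -> f' t = t \/ g' t = t -> t = p.
  by move=> tP /eqP ty /(Pe _ tP)[].
(* Besides y the path has at most one end, so at most one of w, x, z lies on P. If it is w, [f'] on
   P and [g'] off P already form a matching of e. Otherwise [g'] on P and [f'] off P leave y and one
   of x, z to be joined. *)
have [wP|wP] := boolP (w \in P).
  have wp : w = p by apply: endp => //; [rewrite eq_sym|right].
  have xP : x \notin P.
    by apply: contra wx => xP; rewrite wp [x]endp //; left.
  have zP : z \notin P.
    by apply: contra wz => zP; rewrite wp [z]endp //; [rewrite eq_sym|left].
  exists (piecewise P f' g'); split; first exact: piecewise_involutive.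
  move=> t; rewrite /piecewise; case: ifPn => tP.
    by apply: f'e; [apply: contraNneq xP => <-|apply: contraNneq zP => <-].
  by apply: g'e; [apply: contraNneq tP => ->|apply: contraNneq tP => ->].
have gP t : t \in P -> t != y -> e t (g' t).
  by move=> tP ty; apply: g'e => //; apply: contraNneq wP => <-.
have join u : u \notin P -> e y u -> f' u = u ->
    (forall t, t \notin P -> t != u -> e t (f' t)) ->
    exists h, perfect_matching e h.
  move=> uP eyu f'u he; exists (pair_up (piecewise P g' f') y u).
  apply: pair_up_perfect => //.
  - exact: piecewise_involutive.
  - by rewrite /piecewise yP.
  - by rewrite /piecewise (negbTE uP).
  - by move=> t ty tu; rewrite /piecewise; case: ifPn => tP; [exact: gP|exact: he].
have [xP|xP] := boolP (x \in P).
  have zP : z \notin P.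
    apply/negP => zP; have xp : x = p by apply: endp => //; left.
    have zp : z = p by apply: endp => //; [rewrite eq_sym|left].
    by move: xz; rewrite xp -zp eqxx.
  apply: (join z) => // t tP tz; apply: f'e => //.
  by apply: contraNneq tP => ->.
have [zP|zP] := boolP (z \in P).
  apply: (join x) => //; first by rewrite se.
  move=> t tP tx; apply: f'e => //.
  by apply: contraNneq tP => ->.
(* With none of w, x, z on P, [g'] pairs off P minus y while [f'] pairs off all of P: the parities
   clash. *)
have oddP : odd #|P|.
  rewrite (cardsD1 y) yP /=; apply: (@involution_even _ g') => // t; rewrite !inE => /andP[ty tP].
    rewrite Pg // andbT; apply: contra ty => /eqP gt.
    by rewrite -(gK t) gt g'y.
  by have := gP t tP ty; case: eqP => // ->; rewrite ie.
have : ~~ odd #|P|.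
  apply: (@involution_even _ f') => // t tP.
  have : e t (f' t).
    by apply: f'e; [apply: contraNneq xP => <-|apply: contraNneq zP => <-].
  by case: eqP => // ->; rewrite ie.
by rewrite oddP.
Qed.

(** For a labelling constant along the edges within A each class is a union of components, and an
    odd class contains an odd component; odd classes therefore stand in for odd components. *)
Definition odd_labels (c : T -> T) A := [set l | odd #|[set x in A | c x == l]|].

Lemma odd_labels_pair c A x y : x \in A -> y \in A -> x != y -> c x = c y ->
  odd_labels c (A :\ x :\ y) = odd_labels c A.
Proof.
move=> xA yA xy cxy; apply/setP => l; rewrite !inE.
have [cl|cl] := eqVneq (c x) l.
  set B := [set t in A | c t == l].
  have xB : x \in B by rewrite !inE xA cl /=.
  have yB : y \in B :\ x by rewrite !inE eq_sym xy yA -cxy cl /=.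
  rewrite (cardsD1 x B) xB (cardsD1 y (B :\ x)) yB /= negbK.
  congr (odd _); apply: eq_card => t; rewrite !inE.
  by case: (t == x); case: (t == y).
congr (odd _); apply: eq_card => t; rewrite !inE.
case: (eqVneq t x) => [->|_]; first by rewrite (negbTE cl) !andbF.
by case: (eqVneq t y) => [->|_] //; rewrite -cxy (negbTE cl) !andbF.
Qed.

Lemma odd_labels_single c A x : x \in A -> (forall y, y \in A -> c x = c y -> y = x) ->
  odd_labels c (A :\ x) = odd_labels c A :\ c x /\ c x \in odd_labels c A.
Proof.
move=> xA xu.
have cx : [set y in A | c y == c x] = [set x].
  apply/setP => y; rewrite !inE; apply/andP/eqP => [[yA /eqP/esym /(xu _ yA)]//|->].
  by rewrite xA.
split; last by rewrite inE cx cards1.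
apply/setP => l; rewrite !inE; case: (eqVneq l (c x)) => [->|lx] /=.
  rewrite (_ : [set _ in _ | _] = set0) ?cards0 //.
  apply/setP => y; rewrite !inE; apply/negbTE/negP => /andP[/andP[yx yA] /eqP/esym cy].
  by rewrite (xu y yA cy) eqxx in yx.
congr (odd _); apply: eq_card => y; rewrite !inE.
by case: (eqVneq y x) => [->|_] //=; rewrite [c x == l]eq_sym (negbTE lx) andbF.
Qed.

Definition matching_on e A f :=
  forall x, x \in A -> [/\ f x \in A, f (f x) = x & e x (f x)].

Lemma matching_on_pair e A f x y : symmetric e -> x \in A -> y \in A -> x != y -> e x y ->
  matching_on e (A :\ x :\ y) f -> matching_on e A (pair_up f x y).
Proof.
move=> se xA yA xy exy mf t tA; rewrite /pair_up.
case: (eqVneq t x) => [->|tx].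
  by rewrite eqxx eq_sym (negbTE xy).
case: (eqVneq t y) => [->|ty]; first by rewrite eqxx se.
have /mf[] : t \in A :\ x :\ y by rewrite !inE ty tx.
by rewrite !inE => /and3P[/negbTE-> /negbTE-> ->].
Qed.

(* The case where the vertices of U are universal and the label classes outside
   U are cliques. *)
Lemma clique_matching e c U A : symmetric e ->
  (forall u x, u \in U -> u != x -> e u x) ->
  (forall x y, x \notin U -> y \notin U -> x != y -> c x = c y -> e x y) ->
  ~~ odd #|A| -> #|odd_labels c (A :\: U)| <= #|A :&: U| ->
  exists f, matching_on e A f.
Proof.
move=> se eU ec; have [m] := ubnP #|A|; elim: m A => // m IH A lAm evA leA.
have [->|[x0 x0A]] := set_0Vmem A; first by exists id => t; rewrite inE.
have step x y : x \in A -> y \in A -> x != y -> e x y ->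
    #|odd_labels c ((A :\ x :\ y) :\: U)| <= #|(A :\ x :\ y) :&: U| ->
    exists f, matching_on e A f.
  move=> xA yA xy exy le'.
  have yA' : y \in A :\ x by rewrite !inE eq_sym xy.
  have cA : #|A| = #|A :\ x :\ y|.+2.
    by rewrite (cardsD1 x) xA (cardsD1 y (A :\ x)) yA'.
  case: (IH (A :\ x :\ y)) => //.
  - by move: lAm; rewrite cA; lia.
  - by move: evA; rewrite cA /= negbK.
  by move=> f mf; exists (pair_up f x y); exact: matching_on_pair.
(* Pairing inside a class changes no parity. When this is exhausted every class outside U is a
   single vertex, hence odd, and takes a partner from U; what is left of U is even and complete. *)
have [[x [y [xA yA xU yU [xy cxy]]]]|nopair] := pselect (exists x y,
    [/\ x \in A, y \in A, x \notin U, y \notin U & x != y /\ c x = c y]).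
  have xyA : y \in A :\: U by rewrite !inE yU.
  apply: (step x y) => //; first exact: ec.
  have -> : (A :\ x :\ y) :\: U = (A :\: U) :\ x :\ y.
    by apply/setP => t; rewrite !inE; case: (t \in U); rewrite ?andbF.
  rewrite odd_labels_pair ?inE ?xU ?yU //.
  apply: (leq_trans leA); apply: eq_leq; apply: eq_card => t; rewrite !inE.
  case: (eqVneq t x) => [->|_]; first by rewrite (negbTE xU) !andbF.
  by case: (eqVneq t y) => [->|_]; rewrite ?(negbTE yU) ?andbF.
have [AU|[x]] := set_0Vmem (A :\: U); last first.
  rewrite inE => /andP[xU xA].
  have [||oE xo] := @odd_labels_single c (A :\: U) x; rewrite ?inE ?xU //.
    move=> y; rewrite inE => /andP[yU yA] cxy; apply/eqP/negPn/negP => yx.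
    by apply: nopair; exists x, y; split=> //; rewrite eq_sym.
  have [|nu] := pselect (exists u, u \in A :&: U); last first.
    move: leA; rewrite (cardsD1 (c x)) xo.
    suff -> : A :&: U = set0 by rewrite cards0.
    by apply/setP => u; rewrite [in RHS]inE; apply/negP => uAU; apply: nu; exists u.
  case=> u uAU; have := uAU; rewrite inE => /andP[uA uU].
  have ux : u != x by apply: contraNneq xU => <-.
  apply: (step u x) => //; first exact: eU.
  have -> : (A :\ u :\ x) :\: U = (A :\: U) :\ x.
    apply/setP => t; rewrite !inE.
    case: (eqVneq t u) => [->|_]; first by rewrite uU /= ?andbF.
    by case: (t \in U); rewrite ?andbF.
  have -> : (A :\ u :\ x) :&: U = (A :&: U) :\ u.
    apply/setP => t; rewrite !inE.
    case: (eqVneq t x) => [->|_]; first by rewrite (negbTE xU) !andbF.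
    by rewrite /= andbA.
  rewrite oE; move: leA.
  by rewrite (cardsD1 (c x) (odd_labels _ _)) xo (cardsD1 u (A :&: U)) uAU.
have sAU t : t \in A -> t \in U.
  by move=> tA; apply/negPn/negP => tU; move/setP/(_ t): AU; rewrite !inE tU tA.
have [A1|[y yA]] := set_0Vmem (A :\ x0).
  by move: evA; rewrite (cardsD1 x0) x0A A1 cards0.
have /andP[yx yA'] : (y != x0) && (y \in A) by rewrite !inE in yA.
apply: (step x0 y) => //; [by rewrite eq_sym|by apply: eU; rewrite ?sAU // eq_sym|].
suff -> : odd_labels c (A :\ x0 :\ y :\: U) = set0 by rewrite cards0.
apply/setP => l; rewrite !inE (_ : [set _ in _ | _] = set0) ?cards0 //.
apply/setP => t; rewrite !inE; apply/negbTE/negP.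
by case/andP => /andP[tU /and3P[_ _ /sAU tU']] _; rewrite tU' in tU.
Qed.

(* The components of T minus U are represented by a labelling c that is constant
   along edges avoiding U.  Such a labelling remains one when edges are removed,
   so e may be replaced by an edge-maximal graph without perfect matching. *)
Lemma tutte e : symmetric e -> irreflexive e -> ~~ odd #|T| ->
  (exists f, perfect_matching e f) \/
  exists U c, (forall x y, x \notin U -> y \notin U -> e x y -> c x = c y) /\
    #|U| < #|odd_labels c (~: U)|.
Proof.
move=> + + evT.
have [m] := ubnP #|[set p : T * T | ~~ e p.1 p.2]|; elim: m e => // m IH e lem se ie.
pose add (x z a b : T) := [|| e a b, (a == x) && (b == z) | (a == z) && (b == x)].
have addP x z : x != z -> ~~ e x z ->
    (exists f, perfect_matching (add x z) f) \/
    exists U c, (forall a b, a \notin U -> b \notin U -> e a b -> c a = c b) /\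
    #|U| < #|odd_labels c (~: U)|.
  move=> xz nexz; case: (IH (add x z)).
  - move: lem; rewrite ltnS; apply: leq_trans; apply: proper_card.
    apply/properP; split.
      by apply/subsetP => -[a b]; rewrite !inE /add /= negb_or => /andP[].
    by exists (x, z); rewrite !inE /add /= ?eqxx ?orbT.
  - move=> a b; rewrite /add se; congr (_ || _).
    by rewrite orbC; congr (_ || _); rewrite andbC.
  - move=> a; rewrite /add ie /=; apply/negP => /orP[] /andP[/eqP-> /eqP xz'];
      by move: xz; rewrite xz' eqxx.
  - by left.
  - move=> [U [c [cU lU]]]; right; exists U, c; split=> // a b aU bU eab.
    by apply: cU => //; rewrite /add eab.
pose U := [set x | [forall y, (y != x) ==> e x y]].
have UP x y : x \in U -> x != y -> e x y.
  by rewrite inE => /forallP/(_ y)/implyP h xy; apply: h; rewrite eq_sym.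
have nUP x : x \notin U -> exists2 y, x != y & ~~ e x y.
  rewrite inE negb_forall => /existsP[y]; rewrite negb_imply => /andP[yx exy].
  by exists y => //; rewrite eq_sym.
clearbody U.
(* Either adjacency is transitive through vertices outside U, so that the components there are
   cliques, or an induced path x y z with y not universal feeds the exchange step. *)
have [[x [y [z [yU xz exy eyz nexz]]]]|trans] := pselect (exists x y z,
    [/\ y \notin U, x != z, e x y, e y z & ~~ e x z]).
  have [w yw neyw] := nUP _ yU.
  case: (addP x z xz nexz) => [[f pf]|]; last by right.
  case: (addP y w yw neyw) => [[g pg]|]; last by right.
  left; apply: (@matching_exchange e x y z w f g) => //.
  - by apply: contraTneq exy => ->; rewrite ie.
  - by apply: contraTneq eyz => ->; rewrite ie.
  - by apply: contraNneq neyw => ->; rewrite se.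
  - by apply: contraNneq neyw => ->.
pose r x := [set y | (y == x) || e x y] :\: U.
(* Adjacent vertices outside U have the same closed neighbourhood [r], so an element picked from it
   is a canonical name of the clique. *)
pose c x := odflt x [pick y in r x].
have rE x y : x \notin U -> y \notin U -> e x y -> r x = r y.
  move=> xU yU exy; apply/setP => t; rewrite !inE; congr (_ && _).
  have [->|tx] := eqVneq t x; first by rewrite se exy orbT.
  have [->|ty] := eqVneq t y; first by rewrite exy.
  apply/idP/idP => /= et; apply/negPn/negP => net; apply: trans.
    by exists y, x, t; rewrite se; split=> //; rewrite eq_sym.
  by exists x, y, t; split=> //; rewrite eq_sym.
have xr x : x \notin U -> x \in r x by move=> xU; rewrite !inE eqxx xU.
have cr x : x \notin U -> c x \in r x.
  by move=> xU; rewrite /c; case: pickP => [//|/(_ x)]; rewrite xr.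
have cE x y : x \notin U -> y \notin U -> e x y -> c x = c y.
  move=> xU yU exy; rewrite /c (rE x y) //.
  by case: pickP => // /(_ y); rewrite xr.
have cV x y : x \notin U -> y \notin U -> x != y -> c x = c y -> e x y.
  move=> xU yU xy cxy; have := cr _ xU; have := cr _ yU; rewrite -cxy.
  move: (c x) => t; rewrite !inE => /andP[tU /orP[/eqP->|eyt]] /andP[_ /orP[/eqP tx|ext]] //.
  - by rewrite tx eqxx in xy.
  - by rewrite se -tx.
  - apply/negPn/negP => nexy; apply: trans; exists x, t, y; split=> //.
    by rewrite se.
case: (leqP #|odd_labels c (~: U)| #|U|) => [le|lt]; last by right; exists U, c.
left; have [||f mf] := @clique_matching e c U [set: T] se UP cV.
- by rewrite cardsT.
- by rewrite setTD setTI.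
by exists f; split=> x; have [] := mf x (in_setT x).
Qed.
End Tutte.

Lemma odd_sum (I : finType) (P : pred I) (F : I -> nat) :
  odd (\sum_(i | P i) F i) = odd #|[set i | P i && odd (F i)]|.
Proof.
rewrite -sum1_card (big_morph odd oddD (erefl (odd 0))).
rewrite [in RHS](big_morph odd oddD (erefl (odd 0))) /=.
rewrite [RHS](eq_bigl (fun i => P i && odd (F i))); last by move=> i; rewrite inE.
rewrite [RHS]big_mkcondr; apply: eq_bigr => i _; by case: (odd (F i)).
Qed.

(** Each class contributes its own parity. When the total order is even, this upgrades the strict
    inequality of Tutte's theorem to a deficiency of 2. *)
Lemma odd_card_labels (T : finType) (c : T -> T) (A : {set T}) :
  odd #|odd_labels c A| = odd #|A|.
Proof.
rewrite -[#|A| in RHS]sum1_card (partition_big c xpredT) //= odd_sum.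
congr (odd _); apply: eq_card => l; rewrite !inE /= sum1_card.
by congr (odd _); apply: eq_card => x; rewrite !inE.
Qed.

(** * Perfect b-matchings and barriers *)

Section BlowUp.
Variables (T : finType) (e : rel T) (b : T -> nat).
Hypotheses (se : symmetric e) (ie : irreflexive e).

Let B := {x : T & 'I_(b x)}.

Lemma card_fibers (X : {set T}) : #|[set p : B | tag p \in X]| = \sum_(x in X) b x.
Proof.
rewrite -sum1_card.
rewrite (eq_bigr (fun x => \sum_(j : 'I_(b x)) 1)); last first.
  by move=> x _; rewrite sum1_card card_ord.
rewrite (sig_big_dep _ (fun x => fun _ => true) (fun x _ => 1)).
by apply: eq_bigl => p; rewrite inE andbT.
Qed.

(* h F is half the number of copies whose mate lies over the other end of F:
   each matching edge over F is seen from both of its ends. *)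
Lemma perfect_matching_hdeg f : perfect_matching (fun p q : B => e (tag p) (tag q)) f ->
  exists h, forall v, hdeg e h v = b v.
Proof.
move=> [fK fe].
pose E p := [set tag p; tag (f p)].
have Ee p : E p \in edges e by apply/imset2P; exists (tag p) (tag (f p)); rewrite ?inE ?fe.
have Ef p : E (f p) = E p by rewrite /E fK finset.setUC.
exists (fun F => #|[set p | E p == F]|./2) => v.
rewrite /hdeg.
have half F : F \in edges e -> v \in F ->
    #|[set p | E p == F]| = #|[set p | (E p == F) && (tag p == v)]|.*2.
  move=> _ vF.
  have -> : [set p | E p == F] =
     [set p | (E p == F) && (tag p == v)] :|: f @: [set p | (E p == F) && (tag p == v)].
    apply/setP => p; rewrite !inE; apply/idP/orP.
      move=> /eqP Ep; have := vF; rewrite -Ep !inE => /orP[] /eqP vE.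
        by left; rewrite vE !eqxx.
      by right; apply/imsetP; exists (f p); rewrite ?fK // inE Ef vE !eqxx.
    by case=> [/andP[]//|/imsetP[q]]; rewrite inE => /andP[Eq _ ->]; rewrite Ef.
  rewrite cardsU (_ : _ :&: _ = set0) ?cards0 ?subn0 ?card_imset ?addnn //.
    exact: inv_inj.
  apply/setP => p; rewrite !inE; apply/negbTE/negP => /andP[/andP[_ /eqP pv] /imsetP[q]].
  rewrite inE => /andP[_ /eqP qv] pq; have := fe q.
  by rewrite -pq pv qv ie.
under eq_bigr => F /andP[Fe vF] do rewrite (half F Fe vF) doubleK -sum1_card.
have := card_fibers [set v]; rewrite big_set1 => <-.
rewrite -sum1_card [RHS](partition_big E (fun F => (F \in edges e) && (v \in F))) /=.
  by apply: eq_bigr => F _; apply: eq_bigl => p; rewrite !inE andbC.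
by move=> p; rewrite inE => /set1P <-; rewrite Ee !inE eqxx.
Qed.

(** The barrier U of the blow-up is replaced by the set S of vertices all of whose copies it
    contains. Putting the other copies back costs at most one odd class for each of them, which is
    no more than the barrier loses in size. *)
Lemma tutte_weighted : (forall x, 0 < b x) -> ~~ odd (\sum_x b x) ->
  (exists h, forall v, hdeg e h v = b v) \/
  exists (S I : {set T}) (c : T -> B),
  [/\ forall x, (x \in I) = (x \notin S) && [forall y, e x y ==> (y \in S)],
      forall x y, x \notin S -> y \notin S -> e x y -> c x = c y &
      \sum_(x in S) b x + 2 <= \sum_(x in I) b x +
        #|[set l | odd (\sum_(x | (x \notin S :|: I) && (c x == l)) b x)]|].
Proof.
move=> b0 evb.
pose eB (p q : B) := e (tag p) (tag q).
have cB : #|{: B}| = \sum_x b x.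
  have := card_fibers setT; rewrite (eq_bigl xpredT) => [<-|x]; last by rewrite inE.
  by rewrite -cardsT; apply: eq_card => p; rewrite !inE.
have [|||[f /perfect_matching_hdeg]|[U [c [cU lU]]]] := @tutte B eB.
- by move=> p q; rewrite /eB se.
- by move=> p; rewrite /eB ie.
- by rewrite cB.
- by left.
right.
have {}lU : #|U| + 2 <= #|odd_labels c (~: U)|.
  have : odd #|odd_labels c (~: U)| = odd #|U|.
    by rewrite odd_card_labels cardsCs setCK oddB ?max_card // cB (negbTE evb).
  move: lU; lia.
(* A vertex with only some of its copies in U does not disconnect anything. *)
pose S := [set x | [forall j : 'I_(b x), Tagged (fun x => 'I_(b x)) j \in U]].
pose I := [set x | (x \notin S) && [forall y, e x y ==> (y \in S)]].
have SP x : x \notin S -> exists p : B, tag p = x /\ p \notin U.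
  by rewrite inE negb_forall => /existsP[j jU]; exists (Tagged (fun x => 'I_(b x)) j).
have SU (p : B) : tag p \in S -> p \in U.
  by case: p => x j /=; rewrite inE => /forallP; apply.
have IP x : (x \in I) = (x \notin S) && [forall y, e x y ==> (y \in S)].
  by rewrite inE.
clearbody S I.
pose p0 x : B := Tagged (fun x => 'I_(b x)) (Ordinal (b0 x)).
pose r x := odflt (p0 x) [pick p : B | (tag p == x) && (p \notin U)].
have rP x : x \notin S -> tag (r x) = x /\ r x \notin U.
  move=> /SP[p [px pU]]; rewrite /r; case: pickP => [q /andP[/eqP]//|/(_ p)].
  by rewrite px eqxx pU.
have cr (p : B) : p \notin U -> tag p \notin I -> c p = c (r (tag p)).
  move=> pU pI; have pS : tag p \notin S by apply: contra pU; exact: SU.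
  move: pI; rewrite IP pS /= negb_forall => /existsP[y].
  rewrite negb_imply => /andP[epy yS].
  have [ty rU] := rP _ yS; have [tx rxU] := rP _ pS.
  rewrite (cU p (r y)) // ?/eB ?ty //; symmetry; apply: cU => //.
  by rewrite /eB tx ty.
exists S, I, (c \o r); split=> //.
  move=> x y xS yS exy; have [tx xU] := rP _ xS; have [ty yU] := rP _ yS.
  by apply: cU => //; rewrite /eB tx ty.
set Q := [set l | _].
(* [O1]: classes of copies of isolated vertices, at most one for each copy. [O3]: classes that may
   change parity when partially covered fibres are completed. Any other odd class consists of whole
   fibres and is counted in [Q]. *)
pose O1 := c @: [set p : B | tag p \in I].
pose O3 := (fun p => c (r (tag p))) @: (U :\: [set p : B | tag p \in S]).
have sub : odd_labels c (~: U) \subset O1 :|: Q :|: O3.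
  apply/subsetP => l; rewrite inE => oddl.
  rewrite inE; apply/orP.
  have [l3|nl3] := boolP (l \in O3); first by right.
  left; rewrite inE; apply/orP; have [l1|nl1] := boolP (l \in O1); [by left|right].
  rewrite inE /=; move: oddl.
  have := card_fibers [set x | (x \notin S :|: I) && (c (r x) == l)].
  rewrite (eq_bigl (fun x => (x \notin S :|: I) && (c (r x) == l))).
    2: by move=> x; rewrite inE.
  move=> <-; congr (odd _); apply: eq_card => p; rewrite !inE negb_or.
  apply/idP/idP.
    move=> /andP[pU /eqP cp].
    have pI : tag p \notin I.
      by apply: contra nl1 => pI; apply/imsetP; exists p; rewrite ?inE.
    by rewrite pI -cr // cp eqxx !andbT; apply: contra pU; exact: SU.
  move=> /andP[/andP[pS pI] /eqP cp].
  have pU : p \notin U.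
    by apply: contra nl3 => pU; apply/imsetP; exists p; rewrite ?inE ?pS.
  by rewrite pU cr // cp eqxx.
have lO := leq_trans (subset_leq_card sub) (leq_trans (leq_card_setU _ _) (leq_add (leq_card_setU _ _) (leqnn _))).
have c1 : #|O1| <= \sum_(x in I) b x by rewrite -card_fibers; exact: leq_imset_card.
have c3 : #|O3| + \sum_(x in S) b x <= #|U|.
  rewrite -card_fibers -(cardsID [set p : B | tag p \in S] U) addnC.
  apply: leq_add; last exact: leq_imset_card.
  apply: subset_leq_card; apply/subsetP => p; rewrite !inE => pS.
  by rewrite pS andbT SU.
move: c1 c3 (leq_trans lU lO).
move: #|O1| #|O3| #|Q| #|U| (\sum_(x in I) _)%N (\sum_(x in S) _)%N => *.
lia.
Qed.
End BlowUp.

Section Barrier.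
Variables (n k d : nat) (e : rel 'I_n).

Definition isolated_off (S : {set 'I_n}) :=
  [set x | (x \notin S) && [forall y, e x y ==> (y \in S)]].

(** The labels come from a blow-up that depends on the vertex [v] at which criticality fails, hence
    the existential type [L]. *)
Lemma critical_or_barrier : odd k -> 3 <= n -> simple_graph e -> connected_graph e ->
  1 <= d -> d < k -> odd n = odd d ->
  kd_critical e k d \/
  exists (S : {set 'I_n}) (L : finType) (c : 'I_n -> L),
  [/\ S != set0,
      forall x y, x \notin S -> y \notin S -> e x y -> c x = c y &
      k * #|S| + 2 <= k * #|isolated_off S| + d +
       #|[set l | 3 <= #|[set x | (x \notin S :|: isolated_off S) && (c x == l)]|]|].
Proof.
move=> ok n3 [se ie] ce d1 dk nd.
have [crit|ncrit] := pselect (kd_critical e k d); first by left.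
right; have /existsNP[v nv] := ncrit.
pose b (x : 'I_n) := if x == v then k - d else k.
have sumb (A : {set 'I_n}) : \sum_(x in A) b x + (v \in A) * d = k * #|A|.
  have [vA|vA] := boolP (v \in A).
    rewrite (big_setD1 v) //= (cardsD1 v A) vA /b eqxx.
    rewrite (eq_bigr (fun=> k)); last by move=> x; rewrite !inE => /andP[/negbTE->].
    by rewrite sum_nat_const; nia.
  rewrite (eq_bigr (fun=> k)) ?sum_nat_const ?addn0 1?mulnC //.
  by move=> x xA; rewrite /b; case: eqP => // xv; rewrite -xv xA in vA.
have sumT : \sum_x b x + d = k * n.
  have := sumb setT; rewrite (eq_bigl xpredT) => [|x]; last by rewrite inE.
  by rewrite inE mul1n cardsT card_ord.
have [||[h hb]|[S [I [c [IE cS]]]]] := @tutte_weighted _ e b se ie.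
- by move=> x; rewrite /b; case: ifP; lia.
- have : odd (\sum_i b i + d) = odd n by rewrite sumT oddM ok.
  by rewrite oddD nd; case: odd; case: odd.
- case: nv; exists h; split.
  + have hk u : hdeg e h u <= k by rewrite hb /b; case: ifP; lia.
    split=> // f fe; case/imset2P: (fe) => x y _ _ fxy.
    apply: leq_trans (hk x); rewrite /hdeg (bigD1 f) /=; first exact: leq_addr.
    by rewrite fe fxy !inE eqxx.
  + by rewrite hb /b eqxx.
  + by move=> u uv; rewrite hb /b (negbTE uv).
have {IE}-> : I = isolated_off S by apply/setP => x; rewrite IE inE.
set J := isolated_off S; set Q := [set l | odd _] => ineq.
(* If S were empty, connectedness would leave one class and no isolated vertex, hence at most one
   odd class, against a deficiency of 2. *)
have S0 : S != set0.
  apply/eqP => S0; move: ineq.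
  have J0 : J = set0.
    apply/setP => x; rewrite [RHS]inE; apply/negbTE/negP; rewrite inE => /andP[_ /forallP nx].
    have [y yx] : exists y : 'I_n, y != x.
      exists (if val x == 0 then Ordinal (leq_trans (isT : 1 < 3) n3) else
                Ordinal (leq_trans (isT : 0 < 3) n3)).
      by apply/eqP => /(congr1 val) /=; case: ifP => /eqP /=; lia.
    have /connectP[[|z p] /= pth yl] := ce x y; first by rewrite yl eqxx in yx.
    by case/andP: pth => exz _; have := nx z; rewrite exz S0 inE.
  rewrite S0 J0 !big_set0.
  have cc x y : c x = c y.
    have /connectP[p pth ->] := ce x y; elim: p x pth => //= z p IH x /andP[exz /IH <-].
    by apply: cS; rewrite ?S0 ?inE.
  suff : #|Q| <= 1 by lia.
  apply: leq_trans (_ : #|[set c v]| <= 1); last by rewrite cards1.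
  apply: subset_leq_card; apply/subsetP => l; rewrite !inE => oddl.
  apply/eqP/esym/eqP/negPn/negP => cl; move: oddl; rewrite big1 // => x /andP[_ /eqP].
  by rewrite (cc x v) => clx; rewrite clx eqxx in cl.
exists S, {x : 'I_n & 'I_(b x)}, c; split=> //.
set Q3 := [set l | 3 <= _].
(* A class of uniform weight k has odd weight only if its size is odd; a vertex that is not isolated
   has a neighbour in its class, so the size is at least 3. *)
have QQ l : l \in Q -> l != c v \/ v \in S :|: J -> l \in Q3.
  move=> lQ lv; have := sumb [set x | (x \notin S :|: J) && (c x == l)].
  rewrite (_ : v \in _ = false) ?mul0n ?addn0; last first.
    rewrite inE; case: lv => [lv|->//]; by rewrite eq_sym (negbTE lv) andbF.
  rewrite (eq_bigl (fun x => (x \notin S :|: J) && (c x == l))); last first.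
    by move=> x; rewrite inE.
  move=> sumV; rewrite inE in lQ; rewrite sumV in lQ.
  rewrite inE; move: lQ; rewrite oddM ok /=; set V := [set x | _] => oddV.
  have [V0|[x xV]] := set_0Vmem V; first by rewrite V0 cards0 in oddV.
  suff [y yV yx] : exists2 y, y \in V & y != x.
    have yV' : y \in V :\ x by rewrite in_setD1 yx.
    have : 1 < #|V| by rewrite (cardsD1 x) xV (cardsD1 y) yV'.
    by move: oddV; case: #|V| => [|[|[|m]]].
  move: xV; rewrite !inE !negb_or => /andP[/andP[xS]].
  rewrite xS /= negb_forall => /existsP[y]; rewrite negb_imply => /andP[exy yS] /eqP cx.
  exists y; last by apply: contraTneq exy => ->; rewrite ie.
  rewrite !inE negb_or yS /= -(cS x y) // cx eqxx andbT negb_forall.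
  by apply/existsP; exists x; rewrite se exy xS.
have := sumb S; have := sumb J; move: ineq.
(* Inside S or J the reduced weight at [v] is covered by the term d. Elsewhere the class of [v] may
   drop out of [Q3], and d >= 1 absorbs this loss. *)
have [vSJ|vSJ] := boolP (v \in S :|: J).
  have : #|Q| <= #|Q3| by apply: subset_leq_card; apply/subsetP => l lQ; apply: QQ => //; right.
  have : ~~ ((v \in S) && (v \in J)) by rewrite inE; case: (v \in S).
  move: vSJ; rewrite inE -/J.
  move: (\sum_(x in S) b x) (\sum_(x in J) b x) #|Q| #|Q3| #|J| #|S| => a1 a2 a3 a4 a5 a6.
  case: (v \in S); case: (v \in J) => //= _ _; lia.
have : #|Q| <= #|Q3| + 1.
  have -> : 1 = #|[set c v]| by rewrite cards1.
  apply: leq_trans (leq_card_setU _ _); apply: subset_leq_card; apply/subsetP => l lQ.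
  apply/setUP; case: (eqVneq l (c v)) => [->|lv]; first by right; rewrite set11.
  by left; apply: QQ => //; left.
move: vSJ; rewrite inE negb_or -/J => /andP[/negbTE-> /negbTE->].
move: (\sum_(x in S) b x) (\sum_(x in J) b x) #|Q| #|Q3| #|J| #|S| => a1 a2 a3 a4 a5 a6.
lia.
Qed.
End Barrier.

(** * Largest eigenvalue of a symmetric matrix *)

Section Rayleigh.
Import complex spectral sesquilinear.
Local Open Scope ring_scope.
Local Open Scope sesquilinear_scope.

(** Over R[i] the symmetric matrix is Hermitian, so a unitary matrix diagonalises it with real
    eigenvalues; these are roots of the real characteristic polynomial, and in the eigenbasis the
    form is a sum of squared moduli weighted by them. *)
Lemma rayleigh_max (R : rcfType) n (A : 'M[R]_n) : (0 < n)%N -> A^T = A ->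
  exists2 lam, eigenvalue A lam &
    forall x : 'rV_n, (x *m A *m x^T) 0 0 <= lam * (x *m x^T) 0 0.
Proof.
move=> n0 symA; pose toC := real_complex R.
pose A' := map_mx toC A; pose P := spectralmx A'; pose D := spectral_diag A'.
have realC x : toC x \is Num.real by apply/complex_realP; exists x.
have conjR m p (M : 'M[R]_(m, p)) : map_mx Num.conj (map_mx toC M) = map_mx toC M.
  by apply: realmxC; apply/mxOverP => i j; rewrite mxE.
have hermA : A' \is hermsymmx.
  apply: realsym_hermsym; last by apply/mxOverP => i j; rewrite mxE.
  by apply/is_hermitianmxP; rewrite expr0 scale1r map_mx_id // /A' map_trmx symA.
have unitP : P \is unitarymx := spectral_unitarymx A'.
have uP : P \in unitmx := unitarymx_unit unitP.
have AE : A' = invmx P *m diag_mx D *m P.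
  by apply/orthomx_spectralP; exact: hermitian_normalmx.
have realD i : D 0 i \is Num.real.
  by have /mxOverP := hermitian_spectral_diag_real hermA; apply.
pose r i := complex.Re (D 0 i).
have rE i : toC (r i) = D 0 i by exact: RRe_real.
have eigen i : eigenvalue A (r i).
  rewrite eigenvalue_root_char -(fmorph_root (real_complex R)) map_char_poly.
  have -> : (real_complex R : {rmorphism R -> R[i]}) (r i) = D 0 i := rE i.
  rewrite -eigenvalue_root_char; apply/eigenvalueP; exists (row i P).
    rewrite -/A' AE !mulmxA -row_mul mulmxV // row1 -rowE.
    by rewrite row_diag_mx -scalemxAl -rowE.
  apply/eqP => P0; have := row_mul i P (invmx P); rewrite P0 mul0mx mulmxV //.
  by move=> /rowP/(_ i); rewrite !mxE eqxx; apply/eqP; rewrite oner_eq0.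
pose i0 := Ordinal n0.
case: (@arg_maxP _ _ _ i0 xpredT r isT) => im _ maxr.
exists (r im) => // x.
pose x' := map_mx toC x; pose y := x' *m P ^t*.
have xtE : map_mx toC x^T = x' ^t* by rewrite /x' map_trmx conjR.
have nx : toC ((x *m x^T) 0 0) = \sum_i `|y 0 i| ^+ 2.
  have -> : toC ((x *m x^T) 0 0) = (map_mx toC (x *m x^T)) 0 0 by rewrite [RHS]mxE.
  rewrite map_mxM xtE.
  have -> : x' *m x' ^t* = y *m y ^t*.
    by rewrite /y trmx_mul map_mxM trmxCK mulmxA mulmxKtV.
  by rewrite mxE; apply: eq_bigr => i _; rewrite !mxE normCK.
have qx : toC ((x *m A *m x^T) 0 0) = \sum_i D 0 i * `|y 0 i| ^+ 2.
  have -> : toC ((x *m A *m x^T) 0 0) = (map_mx toC (x *m A *m x^T)) 0 0 by rewrite [RHS]mxE.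
  rewrite !map_mxM xtE -/A' AE invmx_unitary // -/x'.
  have -> : x' *m (P ^t* *m diag_mx D *m P) *m x' ^t* = y *m diag_mx D *m y ^t*.
    by rewrite /y trmx_mul map_mxM trmxCK !mulmxA.
  rewrite mul_mx_diag mxE; apply: eq_bigr => i _; rewrite !mxE normCK.
  by rewrite [_ * D 0 i]mulrC -mulrA.
rewrite -lecR rmorphM /= -/toC nx qx mulr_sumr; apply: ler_sum => i _.
apply: ler_wpM2r; first exact: exprn_ge0.
by rewrite -(rE i) lecR; exact: maxr.
Qed.
End Rayleigh.

Section Lambda1.
Local Open Scope ring_scope.
Variables (R : realType) (n : nat).
Implicit Types (A : 'M[R]_n) (x : 'I_n -> R).

Definition qform A x := \sum_i \sum_j A i j * (x i * x j).
Definition sqnorm x := \sum_i x i ^+ 2.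

Lemma qform_row A x : ((\row_i x i) *m A *m (\row_i x i)^T) 0 0 = qform A x.
Proof.
rewrite mxE /qform exchange_big; apply: eq_bigr => j _.
rewrite !mxE mulr_suml; apply: eq_bigr => i _; rewrite !mxE.
by rewrite mulrAC mulrC.
Qed.

Lemma sqnorm_row x : ((\row_i x i) *m (\row_i x i)^T) 0 0 = sqnorm x.
Proof. by rewrite mxE; apply: eq_bigr => i _; rewrite !mxE expr2. Qed.

Lemma sqnorm_gt0 x i : x i != 0 -> 0 < sqnorm x.
Proof.
move=> xi; rewrite /sqnorm (bigD1 i) //= ltr_wpDr //.
  by apply: sumr_ge0 => j _; exact: sqr_ge0.
by rewrite lt_neqAle sqr_ge0 eq_sym expf_neq0.
Qed.

Lemma eigenvalue_qform A a : eigenvalue A a ->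
  exists2 x, (exists i, x i != 0) & forall j, \sum_i x i * A i j = a * x j.
Proof.
move=> /eigenvalueP[v vA v0]; exists (fun i => v 0 i).
  by have [i vi] := rV0Pn _ v0; exists i.
by move=> j; have /rowP/(_ j) := vA; rewrite !mxE.
Qed.

(** The supremum in [lambda1] is attained: the Rayleigh bound, applied to an eigenvector, shows that
    no eigenvalue exceeds the top one. *)
Lemma lambda1_max A : (0 < n)%N -> A^T = A ->
  eigenvalue A (lambda1 A) /\ forall x, qform A x <= lambda1 A * sqnorm x.
Proof.
move=> n0 symA; have [lam elam maxlam] := rayleigh_max n0 symA.
have ub a : eigenvalue A a -> a <= lam.
  move=> /eigenvalueP[v vA v0]; have := maxlam v; rewrite vA -scalemxAl mxE.
  have [i vi] := rV0Pn _ v0.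
  have -> : v = \row_i v 0 i by apply/rowP => j; rewrite mxE.
  rewrite sqnorm_row ler_pM2r //; exact: (@sqnorm_gt0 (fun i => v 0 i) i).
have -> : lambda1 A = lam.
  apply/eqP; rewrite eq_le; apply/andP; split.
    by apply: ge_sup; [exists lam|move=> a /ub].
  by apply: ub_le_sup => //; exists lam => a /ub.
by split=> // x; rewrite -qform_row -sqnorm_row.
Qed.

(** Collatz-Wielandt. For a top eigenvector v, |lambda1| |v| <= |v| A entrywise; pairing with the
    positive vector x and summing in the other order gives the bound. *)
Lemma lambda1_le A x t : (0 < n)%N -> A^T = A -> (forall i j, 0 <= A i j) ->
  (forall i, 0 < x i) -> (forall i, \sum_j A i j * x j <= t * x i) -> lambda1 A <= t.
Proof.
move=> n0 symA A0 x0 Ax; have [/eigenvalue_qform[v [i0 vi0] vA] _] := lambda1_max n0 symA.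
move: (lambda1 A) vA => a vA.
have S0 : 0 < \sum_j `|v j| * x j.
  rewrite (bigD1 i0) //= ltr_wpDr ?mulr_gt0 ?normr_gt0 //.
  by apply: sumr_ge0 => j _; rewrite mulr_ge0 // ltW.
rewrite -(ler_pM2r S0); apply: le_trans (_ : `|a| * \sum_j `|v j| * x j <= _).
  by rewrite ler_pM2r // ler_norm.
rewrite mulr_sumr (le_trans (_ : _ <= \sum_j \sum_i `|v i| * A i j * x j)) //.
  apply: ler_sum => j _; rewrite mulrA -normrM -vA -mulr_suml ler_pM2r //.
  apply: le_trans (ler_norm_sum _ _ _) _; apply: ler_sum => i _.
  by rewrite normrM (ger0_norm (A0 _ _)).
rewrite exchange_big mulr_sumr; apply: ler_sum => i _ /=.
under eq_bigr => j _ do rewrite -mulrA.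
by rewrite -mulr_sumr mulrCA ler_wpM2l.
Qed.

(** Taking absolute values in a top eigenvector keeps the norm and cannot lower the form, so the
    result is again a maximiser; maximality then excludes zero entries. *)
Lemma perron_vector A : (1 < n)%N -> A^T = A -> (forall i, A i i = 0) ->
  (forall i j, i != j -> 0 < A i j) ->
  exists2 x, (forall i, 0 < x i) & qform A x = lambda1 A * sqnorm x.
Proof.
move=> n1 symA A0 Apos; have n0 : (0 < n)%N by exact: ltnW.
have A_ge0 i j : 0 <= A i j by have [->|/Apos/ltW//] := eqVneq i j; rewrite A0.
have [/eigenvalue_qform[v [i0 vi0] vA] maxA] := lambda1_max n0 symA.
move: (lambda1 A) vA maxA => lam vA maxA.
pose x i := `|v i|.
have x_ge0 i : 0 <= x i by exact: normr_ge0.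
have nx : sqnorm x = sqnorm v by apply: eq_bigr => i _; rewrite /x real_normK ?num_real.
have qv : qform A v = lam * sqnorm v.
  rewrite /qform exchange_big mulr_sumr; apply: eq_bigr => j _ /=.
  rewrite expr2 mulrA -vA mulr_suml; apply: eq_bigr => i _; ring.
have qx : qform A x = lam * sqnorm x.
  apply/eqP; rewrite eq_le maxA /= nx -qv; apply: ler_sum => i _; apply: ler_sum => j _.
  by rewrite ler_wpM2l // /x -normrM ler_norm.
exists x => // i; rewrite lt_neqAle normr_ge0 andbT eq_sym; apply/eqP => xi.
pose s := \sum_j A i j * x j.
have s0 : 0 < s.
  have ii0 : i != i0 by apply/eqP => ii; move/eqP: xi; rewrite ii /x normr_eq0 (negbTE vi0).
  rewrite /s (bigD1 i0) //= ltr_wpDr ?mulr_gt0 ?Apos ?normr_gt0 //.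
  by apply: sumr_ge0 => j _; rewrite mulr_ge0.
(* If x vanished at i, increasing that entry would raise the form to first
   order, but the square norm only to second order. *)
pose y eps j := x j + eps *+ (j == i).
have sumdelta (F : 'I_n -> R) eps : \sum_j F j * (eps *+ (j == i)) = F i * eps.
  rewrite (bigD1 i) //= eqxx mulr1n big1 ?addr0 // => j /negbTE->.
  by rewrite mulr0n mulr0.
have ny eps : sqnorm (y eps) = sqnorm x + eps ^+ 2.
  have -> : sqnorm (y eps) = sqnorm x + \sum_j (x j *+ 2 + eps) * (eps *+ (j == i)).
    rewrite -big_split; apply: eq_bigr => j _ /=; rewrite /y.
    by case: (j == i); rewrite /= ?mulr1n ?mulr0n; ring.
  by rewrite sumdelta xi; ring.
have symE k l : A k l = A l k by have /matrixP/(_ l k) := symA; rewrite mxE.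
have qy eps : qform A (y eps) = qform A x + eps * s *+ 2.
  have rowE k : \sum_j A k j * (y eps k * y eps j) =
      \sum_j A k j * (x k * x j) + (\sum_j A k j * x j) * (eps *+ (k == i)) +
      A i k * x k * eps + A i k * eps * (eps *+ (k == i)).
    rewrite -addrA; have -> : A i k * x k * eps + A i k * eps * (eps *+ (k == i)) =
        \sum_j A k j * y eps k * (eps *+ (j == i)).
      by rewrite sumdelta /y symE; ring.
    rewrite mulr_suml.
    rewrite -!big_split; apply: eq_bigr => j _ /=; rewrite /y; ring.
  rewrite /qform (eq_bigr _ (fun k _ => rowE k)) !big_split /= !sumdelta A0 -/s.
  by rewrite -mulr_suml -/s mul0r; ring.
have key eps : eps * s *+ 2 <= lam * eps ^+ 2.
  by have := maxA (y eps); rewrite qy ny qx mulrDr lerD2l.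
(* [key] fails at eps = 1 if lam <= 0, and otherwise at eps = s / lam, where it reads 2 s^2 / lam <=
   s^2 / lam. *)
have [l0|l0] := lerP lam 0.
  by have := key 1; nra.
have := key (s / lam); have -> : lam * (s / lam) ^+ 2 = s / lam * s by field; rewrite gt_eqF.
have : 0 < s / lam * s by rewrite mulr_gt0 ?divr_gt0.
nra.
Qed.
End Lambda1.

(** * Distance matrices *)

Section Distance.
Variables (T : finType) (e : rel T).

Lemma reachP m x y : reflect (exists p, [/\ path e x p, last x p = y & (size p <= m)%N]) (reach e m x y).
Proof.
elim: m y => [|m IH] y /=.
  apply: (iffP eqP) => [->|[[|z p] [_ <- //]]]; by exists [::].
apply: (iffP orP).
  case=> [/IH[p [pp lp sp]]|/existsP[z /andP[/IH[p [pp lp sp]] ezy]]].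
    by exists p; split=> //; exact: leqW.
  exists (rcons p y); split; last by rewrite size_rcons.
    by rewrite rcons_path pp lp.
  by rewrite last_rcons.
case=> p; case: (lastP p) => [|q z] [pp lp sp].
  by left; apply/IH; exists [::].
right; apply/existsP; exists (last x q); move: pp lp sp.
rewrite rcons_path last_rcons size_rcons => /andP[pq ez] <- sq.
by rewrite ez andbT; apply/IH; exists q.
Qed.

Lemma dist_sym x y : symmetric e -> dist e x y = dist e y x.
Proof.
move=> se; rewrite /dist; apply: eq_find => m.
have half a b : reach e m a b -> reach e m b a.
  move=> /reachP[p [pp lp sp]]; apply/reachP; exists (rev (belast a p)); split.
  - by rewrite -lp rev_path; under eq_path do rewrite se.
  - by case: p lp {pp sp} => [|z p] /= lp; rewrite ?lp // rev_cons last_rcons.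
  - by rewrite size_rev size_belast.
by apply/idP/idP; exact: half.
Qed.

Lemma dist_self x : dist e x x = 0%N.
Proof.
rewrite /dist; have : (0 < #|T|)%N by apply/card_gt0P; exists x.
by case: #|T| => //= m _; rewrite eqxx.
Qed.

Lemma card_gt1 (x y : T) : x != y -> (1 < #|T|)%N.
Proof. by move=> xy; rewrite (cardD1 x) (cardD1 y) !inE eq_sym xy. Qed.

(** A failed search in [dist] returns [#|T|], which is at least 2 for distinct points, so the bound
    also holds for unreachable pairs. *)
Lemma dist_ge x y : x != y -> ((~~ e x y).+1 <= dist e x y)%N.
Proof.
move=> xy; have := card_gt1 xy; rewrite /dist.
case: #|T| => [|[|m]] //= _; rewrite (negbTE xy) /=.
case: ifP => //; case: (boolP (e x y)) => // nexy.
by move=> /existsP[z /andP[/eqP<-]]; rewrite (negbTE nexy).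
Qed.

Lemma dist_le x y : (2 < #|T|)%N -> x != y -> (~~ e x y -> exists z, e x z && e z y) ->
  (dist e x y <= (~~ e x y).+1)%N.
Proof.
move=> T3 xy exz; rewrite /dist; move: T3.
case: #|T| => [|[|[|m]]] // _; rewrite [iota _ _]/= /=.
rewrite (negbTE xy) /=; case: ifP => [//|].
case: (boolP (e x y)) exz => [exy _|_ /(_ isT)[z /andP[exz ezy]] _].
  by move/existsP; case; exists x; rewrite eqxx.
case: ifP => // /negP; case; apply/orP; right; apply/existsP; exists z.
by rewrite ezy andbT; apply/orP; right; apply/existsP; exists x; rewrite eqxx.
Qed.
End Distance.

Section GraphLambda.
Local Open Scope ring_scope.
Variables (R : realType) (n : nat).
Implicit Types (e h : rel 'I_n) (x : 'I_n -> R).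

Lemma distmx_sym e : symmetric e -> (distmx R e)^T = distmx R e.
Proof. by move=> se; apply/matrixP => i j; rewrite !mxE dist_sym. Qed.

Definition nonadj_form e x := \sum_i \sum_(j | (i != j) && ~~ e i j) x i * x j.

(** The first two terms are the form of the all-ones matrix minus the identity, distances being at
    least 1; the third is the form of the complement's adjacency matrix, for the pairs at distance
    at least 2. *)
Lemma lambda1_ge e x : (0 < n)%N -> symmetric e -> (forall i, 0 <= x i) ->
  (\sum_i x i) ^+ 2 - sqnorm x + nonadj_form e x <= lambda1 (distmx R e) * sqnorm x.
Proof.
move=> n0 se x0; have [_ /(_ x)] := lambda1_max n0 (distmx_sym se).
apply: le_trans.
have -> : (\sum_i x i) ^+ 2 - sqnorm x = \sum_i \sum_(j | i != j) x i * x j.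
  rewrite expr2 mulr_suml -sumrB; apply: eq_bigr => i _.
  rewrite mulr_sumr (bigD1 i) //= expr2 addrAC subrr add0r.
  by apply: eq_bigl => j; rewrite eq_sym.
rewrite -big_split; apply: ler_sum => i _ /=.
rewrite [X in X + _]big_mkcond [X in _ + X]big_mkcond -big_split; apply: ler_sum => j _ /=.
rewrite mxE; have [->|ij] /= := eqVneq i j; first by rewrite dist_self mul0r addr0.
have xx : 0 <= x i * x j by rewrite mulr_ge0.
have : (((~~ e i j).+1)%:R : R) <= (dist e i j)%:R by rewrite ler_nat dist_ge.
move=> /(ler_wpM2r xx); apply: le_trans.
by case: (e i j); rewrite /= ?addr0 ?mul1r // mulr_natl mulr2n.
Qed.

(** The Perron vector of h, transported along f, tests the form of e. Distances in h are at most 2,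
    so none exceeds its counterpart in e; as f is not an isomorphism, some pair adjacent only in h
    gives a strict gain, weighted by positive entries. *)
Lemma lambda1_lt e h (f : 'I_n -> 'I_n) : (2 < n)%N -> symmetric e -> simple_graph h ->
  bijective f -> (forall i j, e i j -> h (f i) (f j)) -> ~ graph_iso e h ->
  (forall i j, i != j -> ~~ h i j -> exists l, h i l && h l j) ->
  lambda1 (distmx R h) < lambda1 (distmx R e).
Proof.
move=> n3 se [sh ih] bf ehf niso diam.
have n0 : (0 < n)%N by exact: leq_trans n3.
have T3 : (2 < #|'I_n|)%N by rewrite card_ord.
have injf := bij_inj bf.
have [|||x x0 qx] := @perron_vector R n (distmx R h) (ltnW n3).
- exact: distmx_sym.
- by move=> i; rewrite mxE dist_self.
- move=> i j ij; rewrite mxE ltr0n; apply: leq_trans (dist_ge h ij); exact: ltn0Sn.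
have [u [v [uv neuv huv]]] : exists u v, [/\ u != v, ~~ e u v & h (f u) (f v)].
  apply: contrapT => nex; apply: niso; exists f; split=> // a b; apply/idP/idP; first exact: ehf.
  move=> hab; apply/negPn/negP => neab; apply: nex; exists a, b; split=> //.
  by apply: contraTneq hab => ->; rewrite ih.
have [_ /(_ (x \o f))] := lambda1_max n0 (distmx_sym se).
have -> : sqnorm (x \o f) = sqnorm x by rewrite [RHS](reindex f) //; exact: onW_bij.
have S0 : 0 < sqnorm x by apply: (@sqnorm_gt0 _ _ x u); rewrite gt_eqF.
move=> le_q; rewrite -(ltr_pM2r S0) -qx; apply: lt_le_trans le_q.
have -> : qform (distmx R h) x =
    \sum_i \sum_j distmx R h (f i) (f j) * (x (f i) * x (f j)).
  rewrite /qform (reindex f) /=; last exact: onW_bij.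
  by apply: eq_bigr => i _; rewrite (reindex f) //; exact: onW_bij.
have le_ij i j : distmx R h (f i) (f j) <= distmx R e i j.
  rewrite !mxE ler_nat; have [->|ij] := eqVneq i j; first by rewrite !dist_self.
  have fij : f i != f j by rewrite inj_eq.
  apply: leq_trans (dist_ge e ij); apply: leq_trans (dist_le T3 fij (diam _ _ fij)) _.
  by rewrite ltnS; case: (boolP (e i j)) => [/ehf->|_] //=; case: (h _ _).
have x0' i j : 0 <= x (f i) * x (f j) by rewrite mulr_ge0 ?ltW.
rewrite /qform (bigD1 u) //= [ltRHS](bigD1 u) //= ltr_leD //; last first.
  by apply: ler_sum => i _; apply: ler_sum => j _; rewrite ler_wpM2r.
rewrite (bigD1 v) //= [ltRHS](bigD1 v) //= ltr_leD //; last first.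
  by apply: ler_sum => j _; rewrite ler_wpM2r.
rewrite ltr_pM2r ?mulr_gt0 // !mxE ltr_nat; apply: leq_trans (dist_ge e uv).
have fuv : f u != f v by rewrite inj_eq.
by apply: leq_ltn_trans (dist_le T3 fuv (diam _ _ fuv)) _; rewrite huv neuv.
Qed.

(* The entries of distmx h are at most 1 + [~~ h i j], so this is Collatz-Wielandt. *)
Lemma lambda1_diam2_le h x t : (2 < n)%N -> symmetric h ->
  (forall i j, i != j -> ~~ h i j -> exists l, h i l && h l j) -> (forall i, 0 < x i) ->
  (forall i, \sum_(j | i != j) x j + \sum_(j | (i != j) && ~~ h i j) x j <= t * x i) ->
  lambda1 (distmx R h) <= t.
Proof.
move=> n3 sh diam x0 hx; have n0 : (0 < n)%N by exact: leq_trans n3.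
apply: (@lambda1_le R n _ x) => //; first exact: distmx_sym.
  by move=> i j; rewrite mxE.
move=> i; apply: le_trans (hx i).
rewrite [X in _ <= X + _]big_mkcond [X in _ <= _ + X]big_mkcond -big_split.
apply: ler_sum => j _ /=; rewrite mxE.
have [->|ij] /= := eqVneq i j; first by rewrite dist_self mul0r addr0.
have T3 : (2 < #|'I_n|)%N by rewrite card_ord.
have : ((dist h i j)%:R : R) <= ((~~ h i j).+1)%:R by rewrite ler_nat; apply: dist_le (diam _ _ ij).
move=> /(ler_wpM2r (ltW (x0 j))) /le_trans; apply.
by case: (h i j); rewrite /= ?addr0 ?mul1r // mulr_natl mulr2n.
Qed.
End GraphLambda.

(** * Comparison with the extremal graphs *)

Section Extremal.
Local Open Scope ring_scope.
Variable R : realType.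

Lemma kite_simple n : simple_graph (kite_graph n).
Proof.
split=> [x y|x]; rewrite /kite_graph ?eqxx // eq_sym; congr (_ && _).
by rewrite orbCA; congr [|| _, _ | _]; rewrite andbC.
Qed.

Lemma kite_diam n i j : (2 < n)%N -> i != j -> ~~ kite_graph n i j ->
  exists l, kite_graph n i l && kite_graph n l j.
Proof.
case: n i j => // n i j _ ij; rewrite /kite_graph ij !negb_or /= => /and3P[i0 j0 _].
have i0' : i != ord0 by apply: contraNneq i0 => ->.
have j0' : ord0 != j by apply: contraNneq j0 => <-.
by exists ord0; rewrite i0' j0' /= orbT.
Qed.

Lemma S_simple n s : simple_graph (S_graph n s).
Proof. by split=> [x y|x]; rewrite /S_graph ?eqxx // eq_sym orbC. Qed.

Lemma S_diam n s i j : (0 < s)%N -> i != j -> ~~ S_graph n s i j ->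
  exists l, S_graph n s i l && S_graph n s l j.
Proof.
case: n i j => [[]//|n] i j s0 ij; rewrite /S_graph ij negb_or /= => /andP[si sj].
exists ord0; rewrite s0 orbT !andbT; apply/andP; split.
  by apply: contraNneq si => ->.
by apply: contraNneq sj => <-.
Qed.

Lemma sum_neq n (x : 'I_n -> R) i : \sum_(j | i != j) x j = \sum_j x j - x i.
Proof.
rewrite [in RHS](bigD1 i) //= addrAC subrr add0r.
by apply: eq_bigl => j; rewrite eq_sym.
Qed.

(* Test vector: a at the hub, c at the pendant vertex, 1 elsewhere. *)
Lemma kite_le n (t a c : R) : 0 < a -> 0 < c ->
  n.+1%:R + c <= t * a -> a + n%:R + 2 * c <= t -> a + 2 * n.+1%:R <= t * c ->
  lambda1 (distmx R (kite_graph n.+3)) <= t.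
Proof.
move=> a0 c0 ha hb hc.
pose x (i : 'I_n.+3) : R := if i == ord0 then a else if i == ord_max then c else 1.
have sumx : \sum_j x j = a + c + n.+1%:R.
  rewrite big_ord_recl big_ord_recr /= {1}/x eqxx -addrA; congr (_ + _).
  rewrite addrC; congr (_ + _); first by rewrite /x /= -val_eqE /= eqxx.
  rewrite (eq_bigr (fun=> 1)) ?sumr_const ?card_ord // => i _.
  rewrite /x -!val_eqE /=; case: eqP => // /eqP; rewrite /bump /=.
  have := ltn_ord i; lia.
have [sk ik] := kite_simple n.+3.
apply: (@lambda1_diam2_le R n.+3 _ x) => //.
- by move=> i j; exact: kite_diam.
- by move=> i; rewrite /x; case: ifP => // _; case: ifP.
move=> i; rewrite sum_neq sumx.
have [->|i0] := eqVneq i ord0.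
  rewrite big_pred0 => [|j]; last first.
    by rewrite /kite_graph /= andbT; case: eqP.
  rewrite /x eqxx; lra.
have [->|im] := eqVneq i ord_max.
  have nadj j : (ord_max != j) && ~~ kite_graph n.+3 ord_max j = (ord_max != j) && (j != ord0).
    rewrite /kite_graph /= eqxx /= orbF; case: (eqVneq ord_max j) => //= mj.
  rewrite (eq_bigl _ _ nadj).
  have := sum_neq x ord_max; rewrite (bigD1 ord0) //= sumx.
  have -> : x ord0 = a by rewrite /x eqxx.
  have -> : x ord_max = c by rewrite /x /= -val_eqE /= eqxx.
  lra.
have nadj j : (i != j) && ~~ kite_graph n.+3 i j = (j == ord_max).
  rewrite /kite_graph; have [->|jm] := eqVneq j ord_max.
    rewrite im /= eqxx orbF; exact: i0.
  have [//|ij] := eqVneq i j; rewrite /= -[val i == n.+2]/(i == ord_max) (negbTE im).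
  by rewrite -[val j == n.+2]/(j == ord_max) (negbTE jm) !orbT.
rewrite (big_pred1 ord_max) // {1 3}/x (negbTE i0) (negbTE im).
have -> : x ord_max = c by rewrite /x /= -val_eqE /= eqxx.
lra.
Qed.

Lemma card_ltn_ord n s : (s <= n)%N -> #|[pred j : 'I_n | (j < s)%N]| = s.
Proof.
move=> sn; rewrite -sum1_card -(big_ord_widen n (fun=> 1%N) sn).
by rewrite sum_nat_const card_ord muln1.
Qed.

(** Test vector a on the clique part and 1 on the independent part; the two inequalities are its row
    conditions with the diagonal terms moved to the right. *)
Lemma S_le n s (t a : R) : (2 < n)%N -> (0 < s <= n)%N -> 0 < a ->
  s%:R * a + (n%:R - s%:R) <= (t + 1) * a ->
  s%:R * a + 2 * (n%:R - s%:R) <= t + 2 ->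
  lambda1 (distmx R (S_graph n s)) <= t.
Proof.
move=> n3 /andP[s0 sn] a0 ha hb.
pose x (i : 'I_n) : R := if (i < s)%N then a else 1.
have big : \sum_(j < n | ~~ (j < s)%N) x j = n%:R - s%:R.
  rewrite (eq_bigr (fun=> 1)) => [|j /negbTE js]; last by rewrite /x js.
  rewrite sumr_const; have := cardC [pred j : 'I_n | (j < s)%N].
  rewrite card_ltn_ord // card_ord => /(congr1 (fun m => m%:R : R)) <-.
  by rewrite natrD addrAC subrr add0r; congr (_%:R); apply: eq_card.
have sumx : \sum_j x j = s%:R * a + (n%:R - s%:R).
  rewrite (bigID (fun j : 'I_n => (j < s)%N)) /= big; congr (_ + _).
  rewrite (eq_bigr (fun=> a)) => [|j js]; last by rewrite /x js.
  by rewrite sumr_const card_ltn_ord // mulr_natl.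
have [sS _] := S_simple n s.
apply: (@lambda1_diam2_le R n _ x) => //.
- by move=> i j; exact: S_diam.
- by move=> i; rewrite /x; case: ifP.
move=> i; rewrite sum_neq sumx; have [is_|is_] := boolP (i < s)%N.
  rewrite big_pred0 => [|j]; last by rewrite /S_graph is_; case: eqP.
  rewrite /x is_; lra.
have nadj j : (i != j) && ~~ S_graph n s i j = ~~ (j < s)%N && (j != i).
  by rewrite /S_graph (negbTE is_) /= eq_sym; case: (j == i); rewrite ?andbF ?andbT.
rewrite (eq_bigl _ _ nadj); have := big; rewrite (bigD1 i) //= /x (negbTE is_); lra.
Qed.
End Extremal.

(** * Lower bounds from test vectors *)

Section LowerBounds.
Local Open Scope ring_scope.
Variables (R : realType) (n : nat) (e : rel 'I_n).
Hypotheses (n0 : (0 < n)%N) (se : symmetric e).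

(** The all-ones vector makes the form at least n (n - 1) + N. Pairs are ordered, so 3n/2 non-edges
    appear as 3n. *)
Lemma lambda1_gt_nonadj (t : R) (N : nat) :
  (N <= \sum_i #|[set j | (i != j) && ~~ e i j]|)%N ->
  (t + 1 - n%:R) * n%:R < N%:R -> t < lambda1 (distmx R e).
Proof.
move=> leN ltN; have := @lambda1_ge R n e (fun=> 1) n0 se (fun _ => ler01).
have -> : sqnorm (fun _ : 'I_n => (1 : R)) = n%:R.
  by rewrite /sqnorm expr1n sumr_const card_ord.
rewrite sumr_const card_ord => le1; rewrite -(@ltr_pM2r _ n%:R) ?ltr0n //.
apply: lt_le_trans le1.
have : N%:R <= nonadj_form e (fun=> 1 : R).
  rewrite /nonadj_form (eq_bigr (fun i => (#|[set j | (i != j) && ~~ e i j]|)%:R)); last first.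
    move=> i _; rewrite mulr1 sumr_const; congr (_%:R); by apply: eq_card => j; rewrite !inE.
  by rewrite -natr_sum ler_nat.
have n1 : 0 < n%:R :> R by rewrite ltr0n.
nra.
Qed.

Lemma sum_three (S I : {set 'I_n}) (F : R -> R) (a b c : R) : [disjoint S & I] ->
  \sum_i F (if i \in S then a else if i \in I then c else b) =
  #|S|%:R * F a + (n - (#|S| + #|I|))%:R * F b + #|I|%:R * F c.
Proof.
move=> dSI; rewrite (bigID (mem S)) /= -addrA; congr (_ + _).
  rewrite (eq_bigr (fun=> F a)) ?sumr_const ?mulr_natl // => i iS.
  by rewrite iS.
rewrite (bigID (mem I)) /= addrC; congr (_ + _).
  rewrite (eq_bigr (fun=> F b)) => [|i /andP[/negbTE-> /negbTE->]//].
  rewrite sumr_const mulr_natl; congr (_ *+ _).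
  have := cardsC (S :|: I); rewrite card_ord cardsU (disjoint_setI0 dSI) cards0 subn0 => cE.
  have -> : (n - (#|S| + #|I|) = #|~: (S :|: I)|)%N by lia.
  by apply: eq_card => i; rewrite !inE negb_or.
rewrite (eq_bigr (fun=> F c)) => [|i /andP[/negbTE-> ->]//].
rewrite sumr_const mulr_natl; congr (_ *+ _); apply: eq_card => i.
rewrite -[LHS]/((i \notin S) && (i \in I)); case: (boolP (i \in S)) => //= iS.
by rewrite (disjointFr dSI iS).
Qed.

(** Test vector a on S, c on I, b on the other m vertices. I is independent and sees only S, which
    gives s (s - 1) ordered non-adjacent pairs inside I and 2 s m between I and the rest. *)
Lemma lambda1_gt_isolated (S I : {set 'I_n}) (s m : nat) (t a b c : R) :
  I \subset isolated_off e S -> #|S| = s -> #|I| = s -> n = (s.*2 + m)%N ->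
  0 <= a -> 0 <= b -> 0 <= c ->
  (t + 1) * (s%:R * a ^+ 2 + m%:R * b ^+ 2 + s%:R * c ^+ 2) <
  (s%:R * a + m%:R * b + s%:R * c) ^+ 2 + s%:R * (s%:R - 1) * c ^+ 2 + 2 * s%:R * m%:R * b * c ->
  t < lambda1 (distmx R e).
Proof.
move=> sI cS cI nE a0 b0 c0 lt_t.
have dSI : [disjoint S & I].
  rewrite disjoint_sym; apply/pred0P => i /=; apply/negbTE/negP => /andP[/(subsetP sI)].
  by rewrite inE => /andP[/negbTE->].
have mE : (n - (#|S| + #|I|))%N = m by lia.
pose x (i : 'I_n) : R := if i \in S then a else if i \in I then c else b.
have sumx : \sum_i x i = s%:R * a + m%:R * b + s%:R * c.
  by have := sum_three id a b c dSI; rewrite mE cS cI.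
have nx : sqnorm x = s%:R * a ^+ 2 + m%:R * b ^+ 2 + s%:R * c ^+ 2.
  by have := sum_three (fun r => r ^+ 2) a b c dSI; rewrite mE cS cI.
have x0 i : 0 <= x i by rewrite /x; case: ifP => // _; case: ifP.
have := @lambda1_ge R n e x n0 se x0; rewrite sumx nx => le1.
have nonneg : 0 <= s%:R * a ^+ 2 + m%:R * b ^+ 2 + s%:R * c ^+ 2.
  by rewrite !addr_ge0 // mulr_ge0 // sqr_ge0.
have nf : s%:R * (c * (s%:R * c + m%:R * b - c)) + m%:R * (b * (s%:R * c)) <= nonadj_form e x.
  have sumnS : \sum_(j | j \notin S) x j = s%:R * c + m%:R * b.
    have := sumx; rewrite (bigID (mem S)) /= (eq_bigr (fun=> a)) => [|i iS]; last by rewrite /x iS.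
    rewrite sumr_const cS -mulr_natl; lra.
  have sumI : \sum_(j in I) x j = s%:R * c.
    rewrite (eq_bigr (fun=> c)) => [|i iI]; first by rewrite sumr_const cI mulr_natl.
    by rewrite /x (disjointFl dSI iI) iI.
  pose G i : R := if i \in S then 0 else if i \in I then c * (s%:R * c + m%:R * b - c) else b * (s%:R * c).
  have -> : s%:R * (c * (s%:R * c + m%:R * b - c)) + m%:R * (b * (s%:R * c)) = \sum_i G i.
    have := sum_three id 0 (b * (s%:R * c)) (c * (s%:R * c + m%:R * b - c)) dSI.
    by rewrite mE cS cI /= /G => ->; rewrite mulr0 add0r addrC.
  apply: ler_sum => i _; rewrite /G; case: ifPn => iS.
    by apply: sumr_ge0 => j _; rewrite mulr_ge0.
  have isoP k l : k \in I -> l \notin S -> e k l -> false.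
    move=> /(subsetP sI); rewrite inE => /andP[_ /forallP/(_ l)/implyP h] lS /h.
    by rewrite (negbTE lS).
  case: ifPn => iI; rewrite -mulr_sumr {1}/x (negbTE iS) ?iI ?(negbTE iI).
    rewrite ler_wpM2l // -sumnS (bigD1 i) //= {1}/x (negbTE iS) iI addrAC subrr add0r.
    rewrite [leLHS]big_mkcond [leRHS]big_mkcond; apply: ler_sum => j _.
    case: ifP => [/andP[jS ji]|_]; last by case: ifP.
    by rewrite eq_sym ji; case: (boolP (e i j)) => // /(isoP _ _ iI jS).
  rewrite ler_wpM2l // -sumI.
  rewrite [leLHS]big_mkcond [leRHS]big_mkcond; apply: ler_sum => j _.
  case: ifP => [jI|_]; last by case: ifP.
  have -> : i != j by apply: contraNneq iI => ->.
  by case: (boolP (e i j)) => //; rewrite se => /(isoP _ _ jI iS).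
have [nz|nz] := eqVneq (s%:R * a ^+ 2 + m%:R * b ^+ 2 + s%:R * c ^+ 2) 0.
  move: lt_t le1; rewrite nz !mulr0 => lt_t le1; nra.
rewrite -(@ltr_pM2r _ (s%:R * a ^+ 2 + m%:R * b ^+ 2 + s%:R * c ^+ 2)); last by rewrite lt_neqAle eq_sym nz.
apply: lt_le_trans le1; nra.
Qed.
End LowerBounds.

(** * Shape of a graph with a barrier *)

Section BarrierShape.
Variables (n : nat) (e : rel 'I_n).
Hypotheses (se : symmetric e) (ie : irreflexive e).

Lemma classes_card (L : finType) (c : 'I_n -> L) (A : {set 'I_n}) (Q : {set L}) :
  (forall l, l \in Q -> 3 <= #|[set x in A | c x == l]|) ->
  3 * #|Q| <= #|[set x in A | c x \in Q]|.
Proof.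
move=> Q3; rewrite -[#|[set x in A | _]|]sum1_card (partition_big c (mem Q)) /=.
  rewrite mulnC -sum_nat_const; apply: leq_sum => l /[dup] lQ /Q3 /leq_trans; apply.
  rewrite sum1_card; apply: subset_leq_card; apply/subsetP => x.
  by rewrite inE => /andP[xA /eqP xl]; rewrite unfold_in /= inE xA xl lQ eqxx.
by move=> x; rewrite inE => /andP[].
Qed.

(** A vertex off S is adjacent neither to another vertex of J nor to a large class other than its
    own, so it has at least |J| + 3 (|Q| - 1) >= |S| + 5 non-neighbours; at least |S| + 8 vertices
    lie off S, and the total exceeds 3n. *)
Lemma few_isolated_nonadj (L : finType) (c : 'I_n -> L) (S : {set 'I_n}) :
  (forall x y, x \notin S -> y \notin S -> e x y -> c x = c y) ->
  let J := isolated_off e S in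
  let Q := [set l | 3 <= #|[set x | (x \notin S :|: J) && (c x == l)]|] in
  #|J| < #|S| -> 3 * (#|S| - #|J|) <= #|Q| ->
  3 * n < \sum_i #|[set j | (i != j) && ~~ e i j]|.
Proof.
move=> cS J Q ltJ leQ.
have cSJ x : x \in J -> x \notin S by rewrite inE => /andP[].
have isoJ x y : x \in J -> y \notin S -> ~~ e x y.
  rewrite inE => /andP[_ /forallP/(_ y)/implyP h]; by apply: contra.
pose A := ~: (S :|: J).
have Q3 l : l \in Q -> 3 <= #|[set x in A | c x == l]|.
  rewrite inE => /leq_trans; apply; apply: subset_leq_card; apply/subsetP => x.
  by rewrite !inE.
have cA : #|S| + #|J| + #|A| = n.
  have dSJ : [disjoint S & J].
    by rewrite disjoint_sym; apply/pred0P => x /=; apply/negbTE/negP => /andP[/cSJ/negbTE->].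
  by have := cardsC (S :|: J); rewrite card_ord cardsU (disjoint_setI0 dSJ) cards0 subn0 -/A => ->.
have leA : 3 * #|Q| <= #|A|.
  apply: leq_trans (classes_card Q3) _; apply: subset_leq_card; apply/subsetP => x.
  by rewrite inE => /andP[].
have nadj i : i \notin S -> #|J| + 3 * (#|Q| - 1) <= #|[set j | (i != j) && ~~ e i j]|.
  move=> iS; have [iJ|iJ] := boolP (i \in J).
    apply: leq_trans (_ : #|~: S :\ i| <= _).
      have := cardsC S; rewrite card_ord (cardsD1 i (~: S)) inE iS add1n => cSi.
      rewrite -(leq_add2r (#|S| + 1)); move: cA cSi leA leQ ltJ.
      move: #|S| #|J| #|A| #|Q| #|~: S :\ i| => a1 a2 a3 a4 a5; lia.
    apply: subset_leq_card; apply/subsetP => j; rewrite !inE => /andP[ji jS].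
    by rewrite eq_sym ji isoJ.
  have := @classes_card L c A (Q :\ c i); set B := [set x in A | _] => leB.
  have {}leB : 3 * (#|Q| - 1) <= #|B|.
    apply: leq_trans (leB _) => [|l]; last by rewrite inE => /andP[_ /Q3].
    by rewrite leq_mul2l /= (cardsD1 (c i) Q); lia.
  have dJB : [disjoint J & B].
    by apply/pred0P => x /=; apply/negbTE/negP => /andP[xJ]; rewrite inE in_setC in_setU xJ orbT.
  apply: leq_trans (_ : #|J :|: B| <= _).
    by rewrite cardsU (disjoint_setI0 dJB) cards0; lia.
  apply: subset_leq_card; apply/subsetP => j; rewrite in_setU => /orP[jJ|].
    by rewrite inE se isoJ // andbT; apply: contraNneq iJ => ->.
  rewrite [in X in X -> _]inE => /andP[jA /setD1P[cji _]].
  have jS : j \notin S by apply: contraTN jA => jS; rewrite !inE jS.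
  rewrite inE; apply/andP; split; first by apply: contraNneq cji => ->.
  by apply: contra cji => eij; rewrite (cS i j).
apply: leq_trans (_ : \sum_(i | i \notin S) (#|S| + 5) <= _); last first.
  rewrite [X in _ <= X](bigID (fun i => i \in S)) /=; apply: leq_trans (leq_addl _ _).
  apply: leq_sum => i /nadj; apply: leq_trans.
  by move: leQ ltJ; move: #|S| #|J| #|Q| => a1 a2 a3; lia.
rewrite sum_nat_const; have -> : #|[predC S]| = #|J| + #|A|.
  have := cardC (mem S); rewrite card_ord -[X in _ = X -> _]cA -addnA => /addnI <-.
  by apply: eq_card => x; rewrite !inE.
move: cA leA leQ ltJ; move: #|S| #|J| #|Q| #|A| => a1 a2 a3 a4 <-.
nia.
Qed.

(** Any numbering that sends a to 0 and z to the last place works: the kite lacks only the pairs of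
    z with vertices other than a, and z has no such neighbour. *)
Lemma kite_embedding (a z : 'I_n) (n3 : 2 < n) : z \in isolated_off e [set a] ->
  exists2 f : 'I_n -> 'I_n, bijective f & forall x y, e x y -> kite_graph n (f x) (f y).
Proof.
case: n n3 e se ie a z => [//|m] n3 e' se' ie' a z.
rewrite inE => /andP[za /forallP zP]; rewrite inE in za.
pose z' := tperm a ord0 z.
have z'0 : z' != ord0.
  by rewrite /z' -[X in _ != X](tpermL a ord0) (inj_eq perm_inj).
pose p := (tperm a ord0 * tperm z' ord_max)%g.
have pa : p a = ord0.
  by rewrite permM tpermL tpermD // -val_eqE /=; lia.
have pz : p z = ord_max by rewrite permM tpermL.
exists p; first exact/injF_bij/perm_inj.
move=> x y exy; rewrite /kite_graph (inj_eq perm_inj).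
have -> /= : x != y by apply: contraTneq exy => ->; rewrite ie'.
rewrite -[val (p x) == 0]/(p x == ord0) -[val (p y) == 0]/(p y == ord0).
rewrite -[val (p x) == m]/(p x == ord_max) -[val (p y) == m]/(p y == ord_max).
rewrite -pa -pz !(inj_eq perm_inj).
have [//|xa] := eqVneq x a; have [//|ya] := eqVneq y a; rewrite /=.
apply/andP; split; apply: contraTneq exy => ->.
  by apply: contra ya => /(implyP (zP y)); rewrite inE.
by rewrite se'; apply: contra xa => /(implyP (zP x)); rewrite inE.
Qed.

Lemma S_embedding (S : {set 'I_n}) : ~: S \subset isolated_off e S ->
  exists2 f : 'I_n -> 'I_n, bijective f & forall x y, e x y -> S_graph n #|S| (f x) (f y).
Proof.
move=> sI; pose s := enum S ++ enum (~: S).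
have ss x : x \in s by rewrite mem_cat !mem_enum inE; case: (x \in S).
have size_s : size s = n by rewrite size_cat -!cardE cardsC card_ord.
have lt x : index x s < n by rewrite -[X in _ < X]size_s index_mem.
pose f x := Ordinal (lt x).
have injf : injective f.
  by move=> x y /(congr1 val) /= /(congr1 (nth x s)); rewrite !nth_index.
exists f; first exact: injF_bij.
move=> x y exy; rewrite /S_graph (inj_eq injf).
have -> /= : x != y by apply: contraTneq exy => ->; rewrite ie.
have idx t : t \in S -> index t s < #|S|.
  by move=> tS; rewrite index_cat mem_enum tS cardE index_mem mem_enum.
have [/idx->//|xS] := boolP (x \in S).
have := subsetP sI x; rewrite !inE xS => /(_ isT) /forallP/(_ y); rewrite exy => /idx->.
by rewrite orbT.
Qed.
End BarrierShape.

Lemma barrier_shape (n k d : nat) (e : rel 'I_n) :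
  odd k -> 3 <= n -> simple_graph e -> connected_graph e ->
  1 <= d -> d < k -> odd n = odd d -> ~ kd_critical e k d ->
  3 * n < \sum_i #|[set j | (i != j) && ~~ e i j]| \/
  exists S I : {set 'I_n}, [/\ 0 < #|S|, I \subset isolated_off e S, #|I| = #|S|
    & #|S|.*2 <= n].
Proof.
move=> ok n3 sg ce d1 dk nd ncrit; have [se ie] := sg.
have [//|[S [L [c [S0 cS]]]]] := critical_or_barrier ok n3 sg ce d1 dk nd.
set J := isolated_off e S; set Q := [set l | _] => ineq.
have [leSJ|ltJS] := leqP #|S| #|J|; last first.
  left; apply: (few_isolated_nonadj se cS ltJS); rewrite -/J -/Q.
  (* With r = |S| - |J| >= 1 and d < k, the barrier inequality gives |Q| >= k r - d + 2 >= k (r - 1)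
     + 3 >= 3 r. *)
  have k3 : 3 <= k by case: (k) ok dk d1 => [|[|[|k']]] //= _; lia.
  move: ineq ltJS; move: #|S| #|J| #|Q| => a1 a2 a3; nia.
(* Surplus isolated vertices are dropped, so that the comparison depends on s and n alone. *)
right; pose I := [set x in take #|S| (enum J)].
have cI : #|I| = #|S|.
  rewrite cardsE (card_uniqP _) ?take_uniq ?enum_uniq // size_takel //.
  by rewrite -cardE.
have IJ : I \subset J.
  by apply/subsetP => x; rewrite inE => /mem_take; rewrite mem_enum.
exists S, I; split=> //; first by rewrite card_gt0.
have dSI : [disjoint S & I].
  rewrite disjoint_sym; apply/pred0P => x /=; apply/negbTE/negP => /andP[/(subsetP IJ)].
  by rewrite inE => /andP[/negbTE->].
have := max_card (mem (S :|: I)); rewrite card_ord cardsU (disjoint_setI0 dSI) cards0.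
by rewrite subn0 cI addnn.
Qed.

(** * Numerical comparison of largest eigenvalues *)

Section Numerics.
Local Open Scope ring_scope.
Variable R : realType.

Lemma lambda1_gt_isolated1 (n : nat) (e : rel 'I_n) (S I : {set 'I_n}) (s m : nat) (t : R) :
  symmetric e -> (0 < s)%N -> I \subset isolated_off e S -> #|S| = s -> #|I| = s ->
  n = (s.*2 + m)%N ->
  (t + 1 - n%:R) * n%:R < (s * s.-1 + 2 * s * m)%:R -> t < lambda1 (distmx R e).
Proof.
move=> se s0 sI cS cI nE lt_t.
apply: (@lambda1_gt_isolated R n e _ se S I s m t 1 1 1) => //; first by lia.
move: lt_t; rewrite nE -[in (s * _)%N]subn1 natrD -mul2n natrD !natrM natrB //.
move: (s%:R : R) (m%:R : R) => x y; lra.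
Qed.

Lemma kite_le_order2 (n : nat) : (2 < n)%N -> lambda1 (distmx R (kite_graph n)) <= n%:R + 2.
Proof.
case: n => [|[|[|n]]] // _; apply: (@kite_le R n _ 1 2) => //; rewrite -!natr1; lra.
Qed.

(* The decimal constants are rounded Perron vectors. *)
Lemma isolated_gt_kite (n : nat) (e : rel 'I_n) (S I : {set 'I_n}) (s : nat) :
  symmetric e -> odd n || (10 <= n)%N -> (1 < s)%N -> (s.*2 <= n)%N ->
  I \subset isolated_off e S -> #|S| = s -> #|I| = s ->
  lambda1 (distmx R (kite_graph n)) < lambda1 (distmx R e).
Proof.
move=> se on s2 sn sI cS cI.
have [m nE] : exists m, n = (s.*2 + m)%N by exists (n - s.*2)%N; rewrite subnKC.
have ones (t : R) (N : nat) : lambda1 (distmx R (kite_graph n)) <= t ->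
    (N <= s * s.-1 + 2 * s * m)%N -> (t + 1 - n%:R) * n%:R < N%:R ->
    lambda1 (distmx R (kite_graph n)) < lambda1 (distmx R e).
  move=> le1 leN lt1; apply: (le_lt_trans le1).
  apply: (lambda1_gt_isolated1 se (ltnW s2) sI cS cI nE).
  by apply: lt_le_trans lt1 _; rewrite ler_nat.
have [n15|n14] := leqP 15 n.
  apply: (ones (n%:R + 2) (3 * n).+1); first by apply: kite_le_order2; lia.
    by rewrite nE in n15 *; nia.
  have -> : (3 * n).+1%:R = 3 * n%:R + 1 :> R by rewrite -natr1 natrM.
  lra.
have sub_case (t a c : R) (p N : nat) : n = p.+3 -> 0 < a -> 0 < c ->
    p.+1%:R + c <= t * a -> a + p%:R + 2 * c <= t -> a + 2 * p.+1%:R <= t * c ->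
    (N <= s * s.-1 + 2 * s * m)%N -> (t + 1 - p.+3%:R) * p.+3%:R < N%:R ->
    lambda1 (distmx R (kite_graph n)) < lambda1 (distmx R e).
  move=> np a0 c0 h1 h2 h3 leN ltN; apply: (ones t N) => //; last by rewrite np.
  by rewrite np; exact: (kite_le a0 c0).
have : n \in iota 4 11 by rewrite mem_iota; lia.
rewrite [iota _ _]/= !inE => nlist.
repeat (case/orP: nlist => nlist); try (move: nlist; move/eqP=> np; by rewrite np in on);
  move/eqP: nlist => np.
(* Order 5: the all-ones vector yields only 26/5, below the value of the kite, so the weight on S is
   lowered. *)
- have [se2 me] : s = 2 /\ m = 1%N by lia.
  have kb : lambda1 (distmx R (kite_graph n)) <= 536 / 100.
    by rewrite np; apply: (@kite_le R 2 _ (8/10) (1275/1000)); lra.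
  apply: (le_lt_trans kb); rewrite se2 in cS cI; rewrite se2 me in nE.
  by apply: (@lambda1_gt_isolated R n e _ se S I 2 1 _ (69/100) 1 1 sI cS cI nE); [lia|lra..].
(* The last two numbers are n - 3 and the least count over all admissible s. *)
- by apply: (sub_case (77/10) (837/1000) (141/100) 4 12 np); [lra..|nia|lra].
- by apply: (sub_case 10 (86/100) (15/10) 6 20 np); [lra..|nia|lra].
- by apply: (sub_case (1097/100) (872/1000) (154/100) 7 20 np); [lra..|nia|lra].
- by apply: (sub_case (124/10) (9/10) (163/100) 8 30 np); [lra..|nia|lra].
- by apply: (sub_case (134/10) (9/10) (163/100) 9 30 np); [lra..|nia|lra].
- by apply: (sub_case (144/10) (9/10) (163/100) 10 38 np); [lra..|nia|lra].
- by apply: (sub_case (154/10) (9/10) (163/100) 11 42 np); [lra..|nia|lra].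
Qed.

(** With h = n / 2, the weight a rounds the positive root of h a^2 + (h - 1) a - h, which is the
    entry of the Perron vector of S_{n,h} on the clique part when the independent entries are 1. *)
Lemma isolated_gt_S (n : nat) (e : rel 'I_n) (S I : {set 'I_n}) (s : nat) :
  symmetric e -> ~~ odd n -> (4 <= n <= 8)%N -> (0 < s)%N -> (s.*2 < n)%N ->
  I \subset isolated_off e S -> #|S| = s -> #|I| = s ->
  lambda1 (distmx R (S_graph n n./2)) < lambda1 (distmx R e).
Proof.
move=> se on n48 s0 sn sI cS cI.
have [m nE] : exists m, n = (s.*2 + m)%N by exists (n - s.*2)%N; rewrite subnKC // ltnW.
have sub_case (t a : R) (N : nat) : 0 < a ->
    n./2%:R * a + (n%:R - n./2%:R) <= (t + 1) * a ->
    n./2%:R * a + 2 * (n%:R - n./2%:R) <= t + 2 ->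
    (N <= s * s.-1 + 2 * s * m)%N -> (t + 1 - n%:R) * n%:R < N%:R ->
    lambda1 (distmx R (S_graph n n./2)) < lambda1 (distmx R e).
  move=> a0 h1 h2 leN lt1; apply: (@le_lt_trans _ _ t).
    by apply: S_le a0 h1 h2; lia.
  apply: (lambda1_gt_isolated1 se s0 sI cS cI nE).
  by apply: lt_le_trans lt1 _; rewrite ler_nat.
have : [|| n == 4, n == 6 | n == 8]%N.
  by move: on n48; clear; do 9 (case: n => [//|n]).
case/or3P => /eqP np.
- apply: (sub_case (36/10) (78/100) 4); rewrite ?np /=; [lra..|nia|lra].
- apply: (sub_case (62/10) (72/100) 8); rewrite ?np /=; [lra..|nia|lra].
(* For n = 8 and s = 1 the all-ones vector gives 8.5 against about 8.772 for S_{8,4}. The rounded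
   Perron vector of the kite succeeds, though the two values differ by less than 0.01. *)
have [s1|s1] := eqVneq s 1%N; last first.
  apply: (sub_case (8774/1000) (693/1000) 18); rewrite ?np /=; [lra..|nia|lra].
have kb : lambda1 (distmx R (S_graph n n./2)) <= 8774/1000.
  by rewrite np; apply: (@S_le R 8 4 _ (693/1000)) => //; lra.
have m6 : m = 6%N by lia.
apply: (le_lt_trans kb); rewrite s1 in cS cI; rewrite s1 m6 in nE.
by apply: (@lambda1_gt_isolated R n e _ se S I 1 6 _ (85/100) 1 (1464/1000) sI cS cI nE); [lia|lra..].
Qed.

Lemma S_le_order2 (n : nat) : ~~ odd n -> (4 <= n <= 8)%N ->
  lambda1 (distmx R (S_graph n n./2)) <= n%:R + 2.
Proof.
move=> on n48; have nE : n = n./2.*2 by rewrite -[LHS]odd_double_half (negbTE on).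
have hE : n%:R = n./2%:R * 2 :> R by rewrite {1}nE -muln2 natrM.
have h4 : n./2%:R <= 4 :> R by rewrite (ler_nat R _ 4); lia.
(* For the constant vector the independent rows read 3n/2 <= n + 4, that is n <= 8. *)
apply: (@S_le R n n./2 _ 1) => //; [lia|lia|..]; lra.
Qed.
End Numerics.

(** * Assembling the two parts of the theorem *)

Local Open Scope ring_scope.

Theorem theorem2 (R : realType) (k n d : nat) (e : rel 'I_n) :
  odd k -> (3 <= k)%N -> (3 <= n)%N ->
  simple_graph e -> connected_graph e ->
  (1 <= d)%N -> (d < k)%N -> odd n = odd d ->
  ((odd n || (10 <= n)%N) ->
     lambda1 (distmx R e) <= lambda1 (distmx R (kite_graph n)) ->
     ~ graph_iso e (kite_graph n) -> kd_critical e k d) /\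
  (~~ odd n -> (4 <= n <= 8)%N ->
     lambda1 (distmx R e) <= lambda1 (distmx R (S_graph n n./2)) ->
     ~ graph_iso e (S_graph n n./2) -> kd_critical e k d).
Proof.
move=> ok k3 n3 sg ce d1 dk nd; have [se ie] := sg.
have n0 : (0 < n)%N by exact: leq_trans n3.
have dense : (3 * n < \sum_i #|[set j | (i != j) && ~~ e i j]|)%N ->
    n%:R + 2 < lambda1 (distmx R e).
  move=> lt3; apply: (lambda1_gt_nonadj n0 se lt3).
  have -> : (3 * n).+1%:R = 3 * n%:R + 1 :> R by rewrite -natr1 natrM.
  lra.
split=> [on le1 niso|on n48 le1 niso]; apply: contrapT => ncrit.
  have [/dense lt|[S [I [S0 sI cI sn]]]] := barrier_shape ok n3 sg ce d1 dk nd ncrit.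
    by have := lt_le_trans lt (le_trans le1 (kite_le_order2 R n3)); rewrite ltxx.
  have [s1|s2] := leqP #|S| 1.
    have /cards1P[a Sa] : #|S| == 1%N by rewrite eqn_leq s1 S0.
    have /card_gt0P[z zI] : (0 < #|I|)%N by rewrite cI.
    have := subsetP sI _ zI; rewrite Sa => /(kite_embedding se ie n3)[f bf ef].
    have := lambda1_lt R n3 se (kite_simple n) bf ef niso (fun i j => kite_diam n3).
    by rewrite ltNge le1.
  by have := isolated_gt_kite R se on s2 sn sI erefl cI; rewrite ltNge le1.
have [/dense lt|[S [I [S0 sI cI sn]]]] := barrier_shape ok n3 sg ce d1 dk nd ncrit.
  by have := lt_le_trans lt (le_trans le1 (S_le_order2 R on n48)); rewrite ltxx.
have [sn'|ns] := ltnP #|S|.*2 n.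
  by have := isolated_gt_S R se on n48 S0 sn' sI erefl cI; rewrite ltNge le1.
have nE : n = #|S|.*2 by apply/eqP; rewrite eqn_leq ns sn.
have hE : n./2 = #|S| by rewrite {1}nE doubleK.
(* As n = 2 |S|, the set I exhausts the complement of S, so every edge meets S. *)
have SI : ~: S \subset isolated_off e S.
  suff <- : I = ~: S by [].
  apply/eqP; rewrite eqEcard; apply/andP; split.
    by apply/subsetP => x /(subsetP sI); rewrite !inE => /andP[].
  by have := cardsC S; rewrite card_ord cI; lia.
have [f bf ef] := S_embedding ie SI.
rewrite hE in le1 niso.
have := lambda1_lt R n3 se (S_simple n #|S|) bf ef niso (fun i j => S_diam S0).
by rewrite ltNge le1.
Qed.
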